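(* Let $P$ be a locally geometric poset with rank function $\rho$. Then the Orlik–Solomon algebra admits the vector space decomposition $$A(P)\cong\bigoplus_{x\in P}A^{\rho(x)}(P_{\le x}),$$ with the degree-$j$ component of $A(P)=\bigoplus_j A^j(P)$ given by $$A^j(P)\cong\bigoplus_{x\in P,\ \rho(x)=j}A^j(P_{\le x}).$$ The Hilbert series of $A(P)$ is $$H_P(t):=\sum_{j\ge0}\dim(A^j(P))\,t^j=\sum_{x\in P}\mu(x)(-t)^{\rho(x)}=(-t)^{\rho(P)}\chi_P\!\left(-\frac1t\right).$$
   Context: All posets are finite. For a poset $P$ and $x\in P$, $P_{\le x}=\{y\in P: y\le x\}$. For $T\subseteq P$, $\bigvee T$ is the set of minimal common upper bounds of $T$ and $\bigwedge T$ the set of maximal common lower bounds; $x\vee y$ and $x\wedge y$ denote the sets $\bigvee\{x,y\}$ and $\bigwedge\{x,y\}$. A lattice is a poset in which all $x\vee y$ and $x\wedge y$ are singletons. A poset with minimum $\hat 0$ is ranked if there is an order-preserving $\rho:P\to\mathbb{Z}_{\ge0}$ with $\rho(\hat 0)=0$ and $\rho(y)=\rho(x)+1$ whenever $y$ covers $x$; $\rho(P)=\max_{x}\rho(x)$; $\operatorname{at}(P)$ is the set of rank-one elements (atoms). A geometric lattice is a ranked lattice that is atomic (every element is a join of atoms) and semimodular ($\rho(x)+\rho(y)\ge\rho(x\vee y)+\rho(x\wedge y)$). $P$ is locally geometric if it is ranked, has a minimum $\hat 0$, and $P_{\le x}$ is a geometric lattice for every $x\in P$. The Möbius function $\mu:P\to\mathbb{Z}$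 is defined by $\mu(\hat 0)=1$ and $\sum_{y\le x}\mu(y)=0$ for $x>\hat 0$. The characteristic polynomial is $\chi_P(t)=\sum_{x\in P}\mu(x)t^{\rho(P)-\rho(x)}$. For a locally geometric poset $P$, let $S=S(P)=\{(x,T): T\subseteq\operatorname{at}(P),\ x\in\bigvee T\}$, a subposet of $P\times 2^{\operatorname{at}(P)}$ with minimum $\hat 0=(\hat 0,\varnothing)$, and $I=I(P)=\{(x,T)\in S:\rho(x)=|T|\}$. Each $S_{\le\alpha}$ is a Boolean lattice. For $\alpha=(x,T)\in S$, $\operatorname{at}(\alpha)$ is the set of atoms $(a,\{a\})$, $a\in T$, of $S$ below $\alpha$ (identified with $T$), $|\alpha|=|T|$, and for $a\in\operatorname{at}(\alpha)$, $\alpha\setminus a$ is the unique element of $S_{\le\alpha}$ with atom set $\operatorname{at}(\alpha)\setminus\{a\}$. Joins and meets of elements of $S$ are taken in $S$. A circuit is a minimal element of $S\setminus I$; $\omega\in S$ is $\zeta$-unicircular if $\zeta$ is the unique circuit with $\zeta\le\omega$. Fix a linear order on the atoms (inducing one on the atoms of each $P_{\le x}$). For elements (or sets of atoms) with disjoint atom sets $A,B$, $\operatorname{sgn}(A,B)$ is the sign of the permutation sorting the concatenation of $A$ and $B$ (each listed increasingly) into increasing order. $E(P)$ is the free graded-commutative $\mathbb{Q}$-algebra on generators $e_\alpha$, $\alpha\in I\setminus\{\hat 0\}$, with $\deg e_\alpha=|\alpha|$. $J(P)\subseteq E(P)$ is the ideal generated by: (i) $e_\alpha e_\beta$ when $\alpha\wedge\beta\ne\{\hat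 0\}$; (ii) $e_\alpha e_\beta-\operatorname{sgn}(\alpha,\beta)\sum_{\gamma\in(\alpha\vee\beta)\cap I}e_\gamma$ when $\alpha\wedge\beta=\{\hat 0\}$; (iii) $\sum_{a\in\operatorname{at}(\zeta)}\operatorname{sgn}(a,\omega\setminus a)e_{\omega\setminus a}$ when $\omega$ is $\zeta$-unicircular. The Orlik–Solomon algebra is $A(P)=E(P)/J(P)$; it is graded, and $A^j(P)$ denotes its degree-$j$ component. *)

(* Defs.v *)
From HB Require Import structures.
From mathcomp Require Import all_boot all_order perm all_algebra.
From mathcomp Require Import finmap monalg.
From mathcomp Require Import boolp.

Set Implicit Arguments.
Unset Strict Implicit.
Unset Printing Implicit Defensive.

Import Order.Theory GRing.Theory.

Local Open Scope ring_scope.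

Section DirectSum.
Context (K : nzRingType) (I : finType) (V : I -> lmodType K).

(* [I] is finite, so the external direct sum is the product. *)
Definition dsum : predArgType := {dffun forall i, V i}.
HB.instance Definition _ := Choice.on dsum.

Implicit Types f g : dsum.
Definition dsum0 : dsum := [ffun i => 0 : V i].
Definition dsum_opp f : dsum := [ffun i => - f i].
Definition dsum_add f g : dsum := [ffun i => f i + g i].
Definition dsum_scale (k : K) f : dsum := [ffun i => k *: f i].

Fact dsum_addA : associative dsum_add.
Proof. by move=> f g h; apply/ffunP=> i; rewrite !ffunE addrA. Qed.
Fact dsum_addC : commutative dsum_add.
Proof. by move=> f g; apply/ffunP=> i; rewrite !ffunE addrC. Qed.
Fact dsum_add0 : left_id dsum0 dsum_add.
Proof. by move=> f; apply/ffunP=> i; rewrite !ffunE add0r. Qed.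
Fact dsum_addN : left_inverse dsum0 dsum_opp dsum_add.
Proof. by move=> f; apply/ffunP=> i; rewrite !ffunE addNr. Qed.
HB.instance Definition _ :=
  GRing.isZmodule.Build dsum dsum_addA dsum_addC dsum_add0 dsum_addN.

Fact dsum_scaleA a b f : dsum_scale a (dsum_scale b f) = dsum_scale (a * b) f.
Proof. by apply/ffunP=> i; rewrite !ffunE scalerA. Qed.
Fact dsum_scale1 : left_id 1 dsum_scale.
Proof. by move=> f; apply/ffunP=> i; rewrite !ffunE scale1r. Qed.
Fact dsum_scaleDr : right_distributive dsum_scale +%R.
Proof. by move=> a f g; apply/ffunP=> i; rewrite !ffunE scalerDr. Qed.
Fact dsum_scaleDl f : {morph dsum_scale^~ f : a b / a + b}.
Proof. by move=> a b; apply/ffunP=> i; rewrite !ffunE scalerDl. Qed.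
HB.instance Definition _ := GRing.Zmodule_isLmodule.Build K dsum
  dsum_scaleA dsum_scale1 dsum_scaleDr dsum_scaleDl.

End DirectSum.

(* for finite dimensions only: no [n] works for an infinite-dimensional [V] *)
Definition has_dim (K : fieldType) (V : lmodType K) (n : nat) : Prop :=
  exists f : {linear V -> 'rV[K]_n}, bijective f.

(* The quotient may be the zero ring, so in general it is only a pzRingType.  *)

Section IdealQuotient.
Context (K : nzRingType) (R : lalgType K) (G : R -> Prop).

Inductive ideal_of : R -> Prop :=
| ideal_gen x of G x : ideal_of x
| ideal_zero : ideal_of 0
| ideal_add x y of ideal_of x & ideal_of y : ideal_of (x + y)
| ideal_mul u v x of ideal_of x : ideal_of (u * x * v).

Definition idealp : {pred R} := fun x => `[< ideal_of x >].

Lemma idealpP x : reflect (ideal_of x) (x \in idealp).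
Proof. exact: asboolP. Qed.

Fact idealp_zmod : zmod_closed idealp.
Proof.
split=> [|x y /idealpP Ix /idealpP Iy]; apply/idealpP; first exact: ideal_zero.
apply: ideal_add => //.
by rewrite -[- y]mulr1 -mulN1r; apply: ideal_mul.
Qed.
HB.instance Definition _ := GRing.isZmodClosed.Build R idealp idealp_zmod.

Fact idealpMl u x : x \in idealp -> u * x \in idealp.
Proof.
by move=> /idealpP Ix; apply/idealpP; rewrite -[u * x]mulr1; apply: ideal_mul.
Qed.

Fact idealpMr u x : x \in idealp -> x * u \in idealp.
Proof.
by move=> /idealpP Ix; apply/idealpP; rewrite -[x]mul1r; apply: ideal_mul.
Qed.

Fact idealpZ k x : x \in idealp -> k *: x \in idealp.
Proof. by rewrite -[x in _ *: x]mul1r scalerAl; apply: idealpMl. Qed.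

Definition quot_alg : predArgType := Quotient.quot idealp.
HB.instance Definition _ := GRing.Zmodule.on quot_alg.

Definition qpi (x : R) : quot_alg := (\pi_(Quotient.quot idealp) x)%qT.
Definition qrepr (x : quot_alg) : R := repr (x : Quotient.quot idealp).

Lemma qreprK x : qpi (qrepr x) = x. Proof. exact: reprK. Qed.

Lemma qpi_eq x y : (qpi x == qpi y) = (x - y \in idealp).
Proof. by rewrite Quotient.idealrBE. Qed.

Lemma qpi_congr x y : x - y \in idealp -> qpi x = qpi y.
Proof. by rewrite -qpi_eq => /eqP. Qed.

Lemma qreprB x : qrepr (qpi x) - x \in idealp.
Proof. by rewrite -qpi_eq qreprK. Qed.

Fact qpi_zmod : zmod_morphism qpi.
Proof. exact: (raddfB (\pi_(Quotient.quot idealp))%qT). Qed.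
HB.instance Definition _ := GRing.isZmodMorphism.Build R quot_alg qpi qpi_zmod.

Definition quot_scale (k : K) (x : quot_alg) : quot_alg := qpi (k *: qrepr x).
Definition quot_one : quot_alg := qpi 1.
Definition quot_mul (x y : quot_alg) : quot_alg := qpi (qrepr x * qrepr y).

Lemma qpi_scale k x : qpi (k *: x) = quot_scale k (qpi x).
Proof.
by apply/esym/qpi_congr; rewrite -scalerBr idealpZ // qreprB.
Qed.

Lemma qpi_mul x y : qpi (x * y) = quot_mul (qpi x) (qpi y).
Proof.
apply/esym/qpi_congr; set x' := qrepr _; set y' := qrepr _.
rewrite (_ : _ - _ = (x' - x) * y' + x * (y' - y)); last first.
  by rewrite mulrBl mulrBr addrA subrK.
by apply: rpredD; [apply: idealpMr | apply: idealpMl]; apply: qreprB.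
Qed.

Fact quot_scaleA a b x : quot_scale a (quot_scale b x) = quot_scale (a * b) x.
Proof. by rewrite -[x]qreprK -!qpi_scale scalerA. Qed.
Fact quot_scale1 : left_id 1 quot_scale.
Proof. by move=> x; rewrite -[x]qreprK -!qpi_scale scale1r. Qed.
Fact quot_scaleDr : right_distributive quot_scale +%R.
Proof.
move=> a x y; rewrite -[x]qreprK -[y]qreprK -raddfD -!qpi_scale -raddfD.
by rewrite scalerDr.
Qed.
Fact quot_scaleDl x : {morph quot_scale^~ x : a b / a + b}.
Proof.
by move=> a b; rewrite -[x]qreprK -!qpi_scale -raddfD scalerDl.
Qed.
HB.instance Definition _ := GRing.Zmodule_isLmodule.Build K quot_alg
  quot_scaleA quot_scale1 quot_scaleDr quot_scaleDl.

Fact quot_mulA : associative quot_mul.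
Proof.
by move=> x y z; rewrite -[x]qreprK -[y]qreprK -[z]qreprK -!qpi_mul mulrA.
Qed.
Fact quot_mul1l : left_id quot_one quot_mul.
Proof. by move=> x; rewrite -[x]qreprK -!qpi_mul mul1r. Qed.
Fact quot_mul1r : right_id quot_one quot_mul.
Proof. by move=> x; rewrite -[x]qreprK -!qpi_mul mulr1. Qed.
Fact quot_mulDl : left_distributive quot_mul +%R.
Proof.
move=> x y z; rewrite -[x]qreprK -[y]qreprK -[z]qreprK.
by rewrite -raddfD -!qpi_mul -raddfD mulrDl.
Qed.
Fact quot_mulDr : right_distributive quot_mul +%R.
Proof.
move=> x y z; rewrite -[x]qreprK -[y]qreprK -[z]qreprK.
by rewrite -raddfD -!qpi_mul -raddfD mulrDr.
Qed.
HB.instance Definition _ := GRing.Zmodule_isPzRing.Build quot_alg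
  quot_mulA quot_mul1l quot_mul1r quot_mulDl quot_mulDr.

Fact qpi_is_scalable : scalable qpi.
Proof. exact: qpi_scale. Qed.
HB.instance Definition _ := GRing.isScalable.Build K R quot_alg *:%R qpi
  qpi_is_scalable.

Fact qpi_monoid : monoid_morphism qpi.
Proof. by split=> // x y; rewrite qpi_mul. Qed.
HB.instance Definition _ := GRing.isMonoidMorphism.Build R quot_alg qpi
  qpi_monoid.

Lemma quot_scaleAl k (x y : quot_alg) : k *: (x * y) = k *: x * y.
Proof.
rewrite -[x]qreprK -[y]qreprK -(rmorphM qpi).
by rewrite -!(linearZ_LR qpi) -(rmorphM qpi) /= scalerAl.
Qed.

End IdealQuotient.

Local Close Scope ring_scope.
Local Open Scope order_scope.

Section MinMaxBounds.
Context (d : Order.disp_t) (P : finPOrderType d).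
Implicit Types (x y u : P) (T : {set P}).

Definition ubs T : {set P} := [set u | [forall t in T, t <= u]].
Definition lbs T : {set P} := [set u | [forall t in T, u <= t]].
Definition bigvee T : {set P} :=
  [set u in ubs T | [forall v in ubs T, ~~ (v < u)]].
Definition bigwedge T : {set P} :=
  [set u in lbs T | [forall v in lbs T, ~~ (u < v)]].
Definition vee x y : {set P} := bigvee [set x; y].
Definition wedge x y : {set P} := bigwedge [set x; y].

Definition is_lattice : Prop :=
  forall x y, #|vee x y| = 1%N /\ #|wedge x y| = 1%N.

Definition covers y x : bool := (x < y) && [forall z, ~~ (x < z < y)].

End MinMaxBounds.

Section Rank.
Context (d : Order.disp_t) (P : finBPOrderType d).
Implicit Types (rho : P -> nat) (x y : P).

Definition rank_function rho : Prop :=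
  [/\ {homo rho : x y / x <= y >-> (x <= y)%N}, rho \bot = 0%N
    & forall x y, covers y x -> rho y = (rho x).+1].

Definition atoms rho : {set P} := [set x | rho x == 1%N].

Definition rank_of rho : nat := (\max_(x : P) rho x)%N.

Definition atomic rho : Prop :=
  forall x, exists2 T : {set P}, T \subset atoms rho & bigvee T = [set x].

Definition semimodular rho : Prop :=
  forall x y j m, j \in vee x y -> m \in wedge x y ->
    (rho j + rho m <= rho x + rho y)%N.

Definition geometric_lattice : Prop :=
  is_lattice P /\
  exists rho, [/\ rank_function rho, atomic rho & semimodular rho].

End Rank.

Arguments geometric_lattice {d} P.

Section Down.
Context (d : Order.disp_t) (P : finBPOrderType d) (x : P).

Definition down : predArgType := {y : P | y <= x}.
HB.instance Definition _ := SubType.on down.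
HB.instance Definition _ := Finite.on down.
HB.instance Definition _ := [SubChoice_isSubPOrder of down by <: with d].

Definition down_bot : down := exist _ \bot (le0x x).
Fact down_le0 (y : down) : down_bot <= y. Proof. exact: le0x. Qed.
HB.instance Definition _ := Order.hasBottom.Build d down down_le0.

End Down.

Definition locally_geometric (d : Order.disp_t) (P : finBPOrderType d) : Prop :=
  (exists rho : P -> nat, rank_function rho) /\
  forall x : P, geometric_lattice (down x).

Section Moebius.
Context (d : Order.disp_t) (P : finBPOrderType d).
Local Open Scope ring_scope.

(* The first argument is fuel: strict chains of [P] have at most [#|P|]       *)
(* elements. *)
Fixpoint moebius_rec (n : nat) (x : P) : int :=
  if n isn't n'.+1 then 0 else
  if x == \bot%O then 1 else - \sum_(y : P | (y < x)%O) moebius_rec n' y.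

Definition moebius (x : P) : int := moebius_rec #|P| x.

Lemma moebius_recE n x :
  (#|[set y : P | (y <= x)%O]| <= n)%N -> moebius_rec n x = moebius x.
Proof.
rewrite /moebius; have: (#|[set y : P | (y <= x)%O]| <= #|P|)%N.
  exact: max_card.
have c0 y : (#|[set z : P | (z <= y)%O]| <= 0)%N = false.
  by apply/negbTE; rewrite -ltnNge card_gt0; apply/set0Pn; exists y; rewrite inE.
elim: n #|P| x => [|n IHn] [|m] x //=; rewrite ?c0 //.
move=> lem len; case: eqP => // _; congr (- _); apply: eq_bigr => y ltyx.
have pr: [set z | (z <= y)%O] \proper [set z | (z <= x)%O].
  apply/properP; split; first by apply/subsetP=> z; rewrite !inE => /le_trans->//; apply: ltW.
  by exists x; rewrite !inE ?lexx // lt_geF.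
have := proper_card pr => lt.
by apply: IHn; [move: (leq_trans lt lem) | move: (leq_trans lt len)].
Qed.

Lemma moebius0 : moebius \bot%O = 1.
Proof.
rewrite /moebius; case E: #|P| => [|n] /=; last by rewrite eqxx.
by have /card0_eq/(_ \bot%O) := E.
Qed.

Lemma moebius_sum (x : P) :
  (\bot < x)%O -> \sum_(y : P | (y <= x)%O) moebius y = 0.
Proof.
move=> lt0x; rewrite (bigD1 x) //=.
rewrite -(@moebius_recE #|[set y : P | (y <= x)%O]|) //.
case E: #|_| => [|n] /=.
  by move/cards0_eq/setP/(_ x): E; rewrite !inE lexx.
rewrite gt_eqF // addrC; apply/eqP; rewrite subr_eq0; apply/eqP.
apply: eq_big => [y|y /andP[lyx nyx]]; first by rewrite lt_neqAle andbC.
apply/esym/moebius_recE; rewrite -ltnS -E; apply/proper_card/properP; split.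
  by apply/subsetP=> z; rewrite !inE => /le_trans->.
by exists x; rewrite !inE ?lexx // lt_geF // lt_neqAle nyx.
Qed.

Definition characteristic_poly (rho : P -> nat) : {poly int} :=
  \sum_(x : P) moebius x *: 'X^(rank_of rho - rho x).

End Moebius.

Section Signs.
Context (T : finType) (lo : rel T).
Implicit Types (A B : {set T}) (s : seq T).

Definition linear_order_on A : Prop :=
  [/\ {in A, reflexive lo}, {in A &, antisymmetric lo},
      {in A & &, transitive lo} & {in A &, total lo}].

(* unique when [s] is duplicate-free and [lo] is a linear order on it *)
Definition sorting_perm s : 'S_(size s) :=
  odflt 1%g [pick p : 'S_(size s) |
    sorted lo [seq tnth (in_tuple s) (p i) | i <- enum 'I_(size s)]].

Definition sgn A B : rat :=
  ((-1) ^+ sorting_perm (sort lo (enum A) ++ sort lo (enum B)))%R.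

End Signs.

Section PosetS.
Context (d : Order.disp_t) (P : finBPOrderType d) (rho : P -> nat).

Definition in_S (z : P * {set P}) : bool :=
  (z.2 \subset atoms rho) && (z.1 \in bigvee z.2).

Definition Sp : predArgType := {z : P * {set P} | in_S z}.
HB.instance Definition _ := SubType.on Sp.
HB.instance Definition _ := Finite.on Sp.

Implicit Types a b c : Sp.

Definition le_S a b : bool :=
  ((val a).1 <= (val b).1) && ((val a).2 \subset (val b).2).

Fact le_S_refl : reflexive le_S.
Proof. by move=> a; rewrite /le_S lexx subxx. Qed.
Fact le_S_anti : antisymmetric le_S.
Proof.
move=> a b /andP[/andP[l1 s1] /andP[l2 s2]]; apply/val_inj.
case: (val a) (val b) l1 s1 l2 s2 => [x A] [y B] /= l1 s1 l2 s2.
by congr (_, _); [apply/le_anti; rewrite l1 | apply/eqP; rewrite eqEsubset s1].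
Qed.
Fact le_S_trans : transitive le_S.
Proof.
move=> b a c /andP[l1 s1] /andP[l2 s2].
by rewrite /le_S (le_trans l1 l2) (subset_trans s1 s2).
Qed.
HB.instance Definition _ :=
  Order.Le_isPOrder.Build (Order.Disp tt tt) Sp le_S_refl le_S_anti le_S_trans.

Fact bot_in_S : in_S (\bot, set0).
Proof.
rewrite /in_S sub0set /= inE; apply/andP; split.
  by rewrite inE; apply/forall_inP=> t; rewrite inE.
by apply/forall_inP=> v _; rewrite ltx0.
Qed.
Definition bot_S : Sp := exist _ (\bot, set0) bot_in_S.
Fact le_bot_S a : bot_S <= a.
Proof. by rewrite /Order.le /= /le_S /= le0x sub0set. Qed.
HB.instance Definition _ := Order.hasBottom.Build (Order.Disp tt tt) Sp le_bot_S.

(* the set of atoms of an element of [Sp], identified with its second         *)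
(* component *)
Definition at_S a : {set P} := (val a).2.

Definition indep a : bool := rho (val a).1 == #|at_S a|.

(* When [x] is in [at_S a] and [P] is locally geometric, exactly one [b]      *)
(* qualifies. *)
Definition sdel a (x : P) : Sp :=
  odflt \bot [pick b : Sp | (b <= a) && (at_S b == at_S a :\ x)].

Definition circuit a : bool := ~~ indep a && [forall b : Sp, (b < a) ==> indep b].

Definition unicircular z w : bool :=
  [&& circuit z, z <= w & [forall c : Sp, circuit c && (c <= w) ==> (c == z)]].

(* I(P) without its minimum *)
Definition gens : predArgType := {a : Sp | indep a && (a != \bot)}.
HB.instance Definition _ := SubType.on gens.
HB.instance Definition _ := Finite.on gens.

End PosetS.

Section OrlikSolomon.
Context (d : Order.disp_t) (P : finBPOrderType d) (rho : P -> nat) (lo : rel P).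
Local Open Scope ring_scope.

Definition gdeg (g : gens rho) : nat := #|at_S (val g)|.

(* the free associative algebra: finitely supported functions on words *)
Definition freeT := {malg rat[{fmonom (gens rho)}]}.
Definition tgen (g : gens rho) : freeT := << fmu g >>.

Definition graded_comm (x : freeT) : Prop := exists g h : gens rho,
  x = tgen g * tgen h - (-1) ^+ (gdeg g * gdeg h) *: (tgen h * tgen g).

(* Since 2 is invertible, [graded_comm] with [g = h] of odd degree forces     *)
(* [tgen g] to square to zero. *)
Definition freeE : predArgType := quot_alg graded_comm.
HB.instance Definition _ := GRing.Lmodule.on freeE.
HB.instance Definition _ := GRing.PzRing.on freeE.

Fact freeE_one_neq0 : (1 : freeE) != 0.
Proof.
rewrite -(rmorph1 (@qpi _ _ graded_comm)) -(rmorph0 (@qpi _ _ graded_comm)).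
rewrite qpi_eq subr0; apply/negP=> /idealpP I1.
have: mcoeff mone (1 : freeT) = 0.
  elim: I1 => [x [g [h ->]]||x y _ cx _ cy|u v x _ cx].
  - rewrite mcoeffB mcoeffZ !rmorphM /= !mcoeffU1 !fm1_eq1.
    by rewrite !mul0r mulr0 subr0.
  - exact: mcoeff0.
  - by rewrite mcoeffD cx cy addr0.
  - by rewrite !rmorphM /= cx mulr0 mul0r.
by rewrite mcoeff1 eqxx => /eqP; rewrite oner_eq0.
Qed.
HB.instance Definition _ := GRing.PzSemiRing_isNonZero.Build freeE freeE_one_neq0.
HB.instance Definition _ := GRing.Lmodule_isLalgebra.Build rat freeE
  (@quot_scaleAl _ _ graded_comm).

Definition piE : freeT -> freeE := @qpi _ _ graded_comm.

(* The value 0 outside [gens rho] is never used: the sums in [relJ] only      *)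
(* involve nonzero independent elements. *)
Definition egen (a : Sp rho) : freeE :=
  if insub a is Some g then piE (tgen g) else 0.

Inductive relJ : freeE -> Prop :=
| relJ_meet (a b : gens rho) of
    wedge (val a) (val b) != [set \bot%O] :
    relJ (egen (val a) * egen (val b))
| relJ_join (a b : gens rho) of
    wedge (val a) (val b) = [set \bot%O] :
    relJ (egen (val a) * egen (val b)
          - sgn lo (at_S (val a)) (at_S (val b))
            *: \sum_(c in vee (val a) (val b) | indep c) egen c)
| relJ_circuit (z w : Sp rho) of unicircular z w :
    relJ (\sum_(x in at_S z)
            sgn lo [set x] (at_S (sdel w x)) *: egen (sdel w x)).

Definition OS : predArgType := quot_alg relJ.
HB.instance Definition _ := GRing.Lmodule.on OS.
HB.instance Definition _ := GRing.PzRing.on OS.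

Definition piA : freeE -> OS := @qpi _ _ relJ.

Definition word_deg (w : {fmonom (gens rho)}) : nat := (\sum_(g <- w) gdeg g)%N.

Definition homogT (j : nat) (x : freeT) : Prop :=
  forall w, w \in msupp x -> word_deg w = j.

(* the image in [OS] of the span of the words of degree [j] *)
Definition homogOS (j : nat) : {pred OS} :=
  fun a => `[< exists2 x, homogT j x & a = piA (piE x) >].

Fact homogOS_submod j : submod_closed (homogOS j).
Proof.
have pi0 : piA (piE 0) = 0 by rewrite /piA /piE !raddf0.
have piP k x y : piA (piE (k *: x + y)) = k *: piA (piE x) + piA (piE y).
  by rewrite /piA /piE !linearP.
split=> [|k a b /asboolP[x hx ->] /asboolP[y hy ->]]; apply/asboolP.
  by exists 0 => // w; rewrite msupp0.
exists (k *: x + y) => // w /(fsubsetP (msuppD_le _ _)).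
by rewrite inE => /orP[/(fsubsetP (msuppZ_le _ _))/hx|/hy].
Qed.
HB.instance Definition _ j :=
  GRing.isSubmodClosed.Build rat OS (homogOS j) (homogOS_submod j).

Definition OSdeg (j : nat) : predArgType := {a : OS | a \in homogOS j}.
HB.instance Definition _ j := SubChoice.on (OSdeg j).
HB.instance Definition _ j := [SubChoice_isSubLmodule of OSdeg j by <:].

End OrlikSolomon.

Section Below.
Context (d : Order.disp_t) (P : finBPOrderType d) (rho : P -> nat) (lo : rel P).

Definition rank_le (x : P) : down x -> nat := fun y => rho (val y).
Definition lo_le (x : P) : rel (down x) := fun y z => lo (val y) (val z).

Definition OSdeg_le (x : P) (j : nat) : lmodType rat :=
  OSdeg (rank_le (x := x)) (lo_le (x := x)) j.

End Below.

(* Main.v *)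
Require Import Defs.
From HB Require Import structures.
From mathcomp Require Import all_boot all_order perm all_algebra.
From mathcomp Require Import finmap monalg.
From mathcomp Require Import boolp ring.

Set Implicit Arguments.
Unset Strict Implicit.
Unset Printing Implicit Defensive.

Import Order.Theory GRing.Theory.
Local Open Scope ring_scope.

(** Write S for the poset of pairs of an element and a set of atoms of which it
    is a minimal upper bound, and let V be the rational vector space with basis
    [delta c], for c in S. A linear map [to_OS] from V to the Orlik-Solomon algebra
    sends [delta c] to the generator of c if c is independent (to 1 if c is the
    minimum), and to 0 if c is dependent. The proof rests on the description of
    its kernel [rel_sp], lemma [to_OS_eq0]: it is spanned by the [delta c] with c
    dependent and by the circuit relations [circ w], for w of nullity one, that
    is, with one atom more than the rank; these are the unicircular elements.

    The map [to_OS] is onto and vanishes on [rel_sp] because the meet and join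
    relations turn every product of generators into a combination of generators.
    Conversely every generator acts on V by an operator [mul_gen]; these
    operators satisfy the graded commutation, meet and join relations
    ([mul_genC], [mul_gen_meet], [mul_gen_join]), they preserve [rel_sp]
    ([mul_gen_rel]) and send everything into [rel_sp] when combined as in a
    circuit relation ([circuit_rel]). Thus an element of the ideal of relations
    maps V into [rel_sp], and applying it to the basis vector of the minimum
    shows that nothing else is killed.

    Every [circ w] is supported on elements of S with the same first component as
    w. So V modulo [rel_sp] is a direct sum over the points x of the poset, and
    the summand at x only involves the elements below x: it is the component of
    degree equal to the rank of x for the lower interval of x. This gives the
    decomposition of the algebra and of its graded components.

    Let [top_dim x] be the dimension of the summand at x. The Hilbert series
    follows from [moebius_top_dim], which says that up to the sign given by the
    parity of the rank this is the Moebius function. By the recursion of the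
    latter it suffices that the alternating sum of [top_dim y] over y below x
    vanishes when x is not the minimum ([euler_sum]). Below x there is a lattice,
    elements of S are sets of atoms, and the functions on them form an exterior
    algebra, in which [rel_sp] becomes the span D of the dependent sets together
    with the boundaries of D. For an atom a below x, the sum of the boundary map
    and the multiplication by a is an involution [clifford]; it preserves this
    ideal and exchanges even and odd degrees, so that the even and odd parts of
    the quotient have the same dimension. *)

(** * Signs of shuffles *)

Section Sign.
Import Num.Theory.

(** The Vandermonde product of a list. *)
Fixpoint diffprod (l : seq rat) : rat :=
  if l is x :: l' then (\prod_(y <- l') (y - x)) * diffprod l' else 1.

Lemma diffprod_cat l1 l2 : diffprod (l1 ++ l2) =
  diffprod l1 * diffprod l2 * \prod_(x <- l1) \prod_(y <- l2) (y - x).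
Proof.
elim: l1 => [|x l1 IH] /=; first by rewrite big_nil mul1r mulr1.
by rewrite IH big_cat /= big_cons -!mulrA; congr (_ * _); ring.
Qed.

Lemma diffprod_gt0 l : pairwise (fun x y => x < y) l -> 0 < diffprod l.
Proof.
elim: l => //= x l IH /andP[/allP xl /IH l0]; rewrite mulr_gt0 // big_seq.
by apply: prodr_gt0 => y /xl; rewrite subr_gt0.
Qed.

Lemma det_Vandermonde_diffprod n (a : 'rV[rat]_n) :
  \det (Vandermonde n a) = diffprod [seq a 0 i | i <- enum 'I_n].
Proof.
rewrite det_Vandermonde; elim: n a => [|n IH] a.
  by rewrite big_ord0 (size0nil (size_enum_ord 0)).
rewrite enum_ordSl /= big_ord_recl /=; congr (_ * _).
  by rewrite big_mkcond big_ord_recl /= mul1r big_map big_map enumT.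
have := IH (\row_i a 0 (lift ord0 i)); rewrite -map_comp.
under eq_map => i do rewrite /= mxE.
move=> <-; apply: eq_bigr => i _.
rewrite big_mkcond big_ord_recl /= mul1r [RHS]big_mkcond.
by apply: eq_bigr => j _; rewrite !mxE /bump /= !add1n ltnS.
Qed.

Variables (T : finType) (lo : rel T) (At : {set T}).
Hypothesis lo_lin : linear_order_on lo At.
Implicit Types (A B C : {set T}) (a b : T).

Definition sgn1 a b : rat := if lo a b then 1 else -1.

Lemma sgn1V a b : a \in At -> b \in At -> a != b -> sgn1 a b = - sgn1 b a.
Proof.
case: lo_lin => _ asym _ tot aA bA; rewrite /sgn1.
have := asym a b aA bA; have := tot a b aA bA.
by case: (lo a b); case: (lo b a) => //= _; rewrite ?opprK // => ->; rewrite ?eqxx.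
Qed.

Lemma sgn1K a b : sgn1 a b * sgn1 a b = 1.
Proof. by rewrite /sgn1; case: ifP; rewrite ?mulrNN mulr1. Qed.

(* An order embedding of [At] into the rationals. *)
Let h a : rat := #|[set b in At | lo b a]|%:R.

Lemma order_height_lt a b : a \in At -> b \in At -> a != b -> lo a b -> h a < h b.
Proof.
case: lo_lin => refl asym tr _ aA bA nab lab; rewrite ltr_nat proper_card //.
apply/properP; split.
  apply/subsetP=> c; rewrite !inE => /andP[cA lca]; rewrite cA.
  exact: (tr a c b).
exists b; rewrite !inE bA ?refl //=; apply: contra nab => lba.
by apply/eqP/asym; rewrite ?lab.
Qed.

Lemma sgr_height a b : a \in At -> b \in At -> a != b ->
  Num.sg (h b - h a) = sgn1 a b.
Proof.
move=> aA bA nab; have [lab|lab] := boolP (lo a b).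
  by rewrite /sgn1 lab gtr0_sg // subr_gt0 order_height_lt.
have lba : lo b a.
  by case: lo_lin => _ _ _ /(_ a b aA bA); rewrite (negPf lab).
rewrite /sgn1 (negPf lab) ltr0_sg // subr_lt0 order_height_lt //.
by rewrite eq_sym.
Qed.

Lemma sorted_height (l : seq T) : {subset l <= At} -> uniq l -> sorted lo l ->
  pairwise (fun x y => x < y) [seq h a | a <- l].
Proof.
case: lo_lin => _ _ tr _ /allP lA ul; rewrite (sorted_pairwise_in tr) //.
rewrite pairwise_map; elim: l lA ul => //= a l IH.
move=> /andP[aA lA] /andP[nal ul] /andP[al pl]; rewrite IH // andbT.
apply/allP=> b bl; apply: order_height_lt => //; first exact: (allP lA).
  by apply: contraNneq nal => ->.
exact: (allP al).
Qed.

Lemma sort_height A : A \subset At ->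
  pairwise (fun x y => x < y) [seq h i | i <- sort lo (enum A)].
Proof.
move=> /subsetP sA; case: (lo_lin) => _ _ _ tot.
apply: sorted_height; rewrite ?sort_uniq ?enum_uniq //.
  by move=> a; rewrite mem_sort mem_enum => /sA.
by apply: (sort_sorted_in tot); apply/allP=> a; rewrite mem_enum => /sA.
Qed.

Lemma sorting_perm_diffprod (s : seq T) :
  uniq s -> {subset s <= At} ->
  (-1) ^+ sorting_perm lo s = Num.sg (diffprod [seq h i | i <- s]) :> rat.
Proof.
move=> us sA; case: (lo_lin) => refl asym tr tot; rewrite /sorting_perm.
case: pickP => [p /= sp|nop]; last first.
  have /tuple_permP[p Ep] : perm_eq (sort lo s) (in_tuple s).
    by rewrite perm_sort.
  have /allP allA : {subset s <= mem At} by [].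
  have := sort_sorted_in tot allA.
  rewrite Ep /= => so; have /negP[] := nop p.
  exact: so.
set s' := [seq _ | _ <- _] in sp.
have ps : perm_eq s' s.
  apply/(@tuple_permP _ _ _ (in_tuple s)); exists p.
  by rewrite /s' /=.
have: pairwise (fun x y => x < y) [seq h i | i <- s'].
  apply: sorted_height => //; first by move=> a; rewrite (perm_mem ps) => /sA.
  by rewrite (perm_uniq ps).
move=> /diffprod_gt0.
pose a := \row_(i < size s) h (tnth (in_tuple s) i).
have -> : [seq h i | i <- s] = [seq a 0 i | i <- enum 'I_(size s)].
  have -> : [seq h i | i <- s] = [seq h i | i <- in_tuple s] by [].
  by rewrite -map_tnth_enum -map_comp; apply: eq_map => i; rewrite /= mxE.
have -> : [seq h i | i <- s'] = [seq (col_perm p a) 0 i | i <- enum 'I_(size s)].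
  by rewrite /s' -map_comp; apply: eq_map => i; rewrite !mxE.
rewrite -!det_Vandermonde_diffprod.
have -> : Vandermonde (size s) (col_perm p a) = col_perm p (Vandermonde (size s) a).
  by apply/matrixP=> i j; rewrite !mxE.
rewrite col_permE det_mulmx det_perm odd_permV => gt0.
have := gtr0_sg gt0; rewrite sgrM.
case: (p : bool) {gt0}; rewrite ?expr1 ?expr0 ?sgr1 ?mulr1 //.
by rewrite sgrN1 mulrN1 => /eqP; rewrite eqr_oppLR => /eqP.
Qed.

(** The sign of a shuffle counts inversions: a Vandermonde determinant changes
    by the sign of the permutation of its columns, and its sign is the product
    of the signs of the differences. *)
Lemma sgnE A B : A \subset At -> B \subset At -> [disjoint A & B] ->
  sgn lo A B = \prod_(a in A) \prod_(b in B) sgn1 a b.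
Proof.
move=> AA BA dAB; rewrite /sgn sorting_perm_diffprod; last first.
- by move=> a; rewrite mem_cat !mem_sort !mem_enum => /orP[/(subsetP AA)|/(subsetP BA)].
- rewrite cat_uniq !sort_uniq !enum_uniq /= andbT -all_predC; apply/allP=> b /=.
  rewrite !mem_sort !mem_enum => bB; apply/negP=> bA.
  by have := disjointFr dAB bA; rewrite bB.
rewrite map_cat diffprod_cat !sgrM gtr0_sg; last exact/diffprod_gt0/sort_height.
rewrite gtr0_sg ?mul1r; last exact/diffprod_gt0/sort_height.
rewrite big_map (perm_big _ (permEl (perm_sort _ _))) /= big_enum /=.
rewrite (big_morph _ (sgrM (R := rat)) (sgr1 _)); apply: eq_bigr => a aA.
rewrite big_map (perm_big _ (permEl (perm_sort _ _))) /= big_enum /=.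
rewrite (big_morph _ (sgrM (R := rat)) (sgr1 _)); apply: eq_bigr => b bB.
apply: sgr_height; [exact: (subsetP AA) | exact: (subsetP BA) |].
by apply: contraTneq bB => <-; rewrite (disjointFr dAB aA).
Qed.

End Sign.

Section SignProduct.
Variables (T : finType) (lo : rel T) (At : {set T}).
Hypothesis lo_lin : linear_order_on lo At.
Implicit Types (A B C : {set T}) (a b : T).

(** The inversion count of the shuffle, as a sign defined for all sets: unlike
    [sgn] it is multiplicative in each argument. *)
Definition shuffle A B : rat := \prod_(a in A) \prod_(b in B) sgn1 lo a b.

Lemma sgn_shuffle A B : A \subset At -> B \subset At -> [disjoint A & B] ->
  sgn lo A B = shuffle A B.
Proof. exact: sgnE. Qed.

Lemma prod_setU A B (F : T -> rat) : [disjoint A & B] ->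
  \prod_(a in A :|: B) F a = (\prod_(a in A) F a) * (\prod_(a in B) F a).
Proof. by move=> dAB; rewrite -bigU //; apply: eq_bigl => a; rewrite !inE. Qed.

Lemma shuffleUl A B C : [disjoint A & B] ->
  shuffle (A :|: B) C = shuffle A C * shuffle B C.
Proof. exact: prod_setU. Qed.

Lemma shuffleUr A B C : [disjoint B & C] ->
  shuffle A (B :|: C) = shuffle A B * shuffle A C.
Proof.
move=> dBC; rewrite /shuffle -big_split /=; apply: eq_bigr => a _.
exact: prod_setU.
Qed.

Lemma shuffle0l A : shuffle set0 A = 1.
Proof. by rewrite /shuffle big_set0. Qed.

Lemma shuffleK A B : shuffle A B * shuffle A B = 1.
Proof.
rewrite /shuffle -big_split big1 //= => a _.
by rewrite -big_split big1 //= => b _; rewrite sgn1K.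
Qed.

Lemma shuffleC A B : A \subset At -> B \subset At -> [disjoint A & B] ->
  shuffle A B = (-1) ^+ (#|A| * #|B|) * shuffle B A.
Proof.
move=> sA sB dAB; rewrite /shuffle [in RHS]exchange_big /=.
rewrite mulnC exprM -prodr_const -big_split /=; apply: eq_bigr => a aA.
rewrite -prodr_const -big_split /=; apply: eq_bigr => b bB.
rewrite mulN1r; apply: (sgn1V lo_lin); [exact: (subsetP sA) | exact: (subsetP sB) |].
by apply: contraTneq bB => <-; rewrite (disjointFr dAB aA).
Qed.

End SignProduct.

(** * Joins below an element, and the poset S *)

Section LocalSemimodular.
Context (d : Order.disp_t) (P : finBPOrderType d) (rho : P -> nat).
Local Open Scope order_scope.
Implicit Types (x y z u v a b : P) (T U : {set P}).

(** Joins below every element, and semimodularity for an element and an atom,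
    stated inside the poset so that the hypothesis restricts to lower intervals. *)
Record local_semimodular : Prop := LocalSemimodular {
  lsm_rank : rank_function rho;
  lsm_join : forall z x y, x <= z -> y <= z -> exists j,
    [/\ j <= z, x <= j, y <= j,
        forall v, v <= z -> x <= v -> y <= v -> j <= v
      & rho y = 1%N -> (rho j <= (rho x).+1)%N] }.

Hypothesis lsm : local_semimodular.
Let rk := lsm_rank lsm.

Lemma exists_cover x y : x < y -> exists2 w, covers w x & w <= y.
Proof.
move=> xy; have y0 : (x < y) && (y <= y) by rewrite xy lexx.
case: (@arg_minnP _ y (fun w => (x < w) && (w <= y)) (fun w => #|[set u | u <= w]|) y0).
move=> w /andP[xw wy] wmin.
exists w => //; rewrite /covers xw; apply/forallP=> z; apply/negP=> /andP[xz zw].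
have := wmin z; rewrite xz (le_trans (ltW zw) wy) => /(_ isT).
rewrite leqNgt => /negP[]; apply/proper_card/properP; split.
  by apply/subsetP=> u; rewrite !inE => /le_trans; apply; apply: ltW.
by exists w; rewrite !inE ?lexx // lt_geF.
Qed.

Lemma rank_le_mono x y : x <= y -> (rho x <= rho y)%N.
Proof. by case: rk => h _ _; apply: h. Qed.

Lemma rank_lt x y : x < y -> (rho x < rho y)%N.
Proof.
case: rk => h _ hc /exists_cover[w /hc xw wy].
by rewrite -xw; apply: h.
Qed.

Lemma rank_inj_le x y : x <= y -> rho x = rho y -> x = y.
Proof.
rewrite le_eqVlt => /orP[/eqP //|/rank_lt lt e].
by rewrite e ltnn in lt.
Qed.

Lemma rank_eq0 x : (rho x == 0%N) = (x == \bot).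
Proof.
apply/eqP/eqP => [r0|->]; last by case: rk.
by apply/esym/rank_inj_le; rewrite ?le0x // r0; case: rk.
Qed.

Lemma exists_atom x : \bot < x -> exists2 a, a \in atoms rho & a <= x.
Proof.
move=> /exists_cover[a ca ax]; exists a => //; rewrite inE.
by case: rk => _ r0 /(_ _ _ ca) ->; rewrite r0.
Qed.

Lemma exists_lub z (s : seq P) : (forall t, t \in s -> t <= z) -> exists u,
  [/\ u <= z, forall t, t \in s -> t <= u
    & forall v, v <= z -> (forall t, t \in s -> t <= v) -> u <= v].
Proof.
elim: s => [|x s IH] sz.
  by exists \bot; split => // *; rewrite le0x.
have [|u [uz su umin]] := IH; first by move=> t ts; rewrite sz // inE ts orbT.
have [|j [jz uj xj jmin _]] := lsm_join lsm uz (_ : x <= z).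
  by rewrite sz // mem_head.
exists j; split=> // [t|v vz sv].
  by rewrite inE => /orP[/eqP->//|/su tu]; apply: le_trans tu uj.
apply: jmin => //; last by rewrite sv // mem_head.
by apply: umin => // t ts; rewrite sv // inE ts orbT.
Qed.

Lemma ubsP T u : reflect (forall t, t \in T -> t <= u) (u \in ubs T).
Proof. by rewrite inE; apply: (iffP forall_inP). Qed.

(** Minimality of [u] only involves upper bounds below [u], so that it can be
    tested in any lower interval that contains [u]. *)
Lemma bigveeP T u : reflect
  ((forall t, t \in T -> t <= u) /\
   forall v, v <= u -> (forall t, t \in T -> t <= v) -> v = u)
  (u \in bigvee T).
Proof.
rewrite inE; apply: (iffP andP) => [[/ubsP Tu /forall_inP umin]|[Tu umin]].
  split=> // v vu Tv; apply/eqP; have /umin : v \in ubs T by apply/ubsP.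
  by rewrite lt_neqAle vu andbT negbK.
split; first exact/ubsP.
apply/forall_inP=> v /ubsP Tv; apply/negP=> vu.
by move: (vu); rewrite (umin v) ?ltxx // ltW.
Qed.

Local Notation S := (Sp rho).
Implicit Types c e g w : S.

Definition top_S c : P := (val c).1.

Lemma le_SE c e : (c <= e) = (top_S c <= top_S e) && (at_S c \subset at_S e).
Proof. by []. Qed.

Lemma le_top c e : c <= e -> top_S c <= top_S e.
Proof. by rewrite le_SE => /andP[]. Qed.

Lemma le_at c e : c <= e -> at_S c \subset at_S e.
Proof. by rewrite le_SE => /andP[]. Qed.

Lemma at_S_sub c : at_S c \subset atoms rho.
Proof. by case/andP: (valP c). Qed.

Lemma top_vee c : top_S c \in bigvee (at_S c).
Proof. by case/andP: (valP c). Qed.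

Lemma at_le_top c a : a \in at_S c -> a <= top_S c.
Proof. by case/bigveeP: (top_vee c) => h _; apply: h. Qed.

Lemma eq_S c e : top_S c = top_S e -> at_S c = at_S e -> c = e.
Proof.
move=> h1 h2; apply/val_inj; rewrite [LHS]surjective_pairing [RHS]surjective_pairing.
by rewrite -/(top_S c) -/(top_S e) h1 -/(at_S c) h2.
Qed.

Definition atoms_le z : {set P} := [set a in atoms rho | a <= z].

Lemma at_S_le c z : top_S c <= z -> at_S c \subset atoms_le z.
Proof.
move=> cz; apply/subsetP=> a ac; rewrite inE (subsetP (at_S_sub c)) //=.
exact: le_trans (at_le_top ac) cz.
Qed.

Lemma atoms_leS y z : y <= z -> atoms_le y \subset atoms_le z.
Proof.
by move=> yz; apply/subsetP=> a; rewrite !inE => /andP[-> /le_trans->].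
Qed.

(** The element of S below [z] with atom set [T]: its first component is the
    join of [T] in the lattice of elements below [z]. *)
Definition flat z T : S := odflt \bot [pick c : S | (top_S c <= z) && (at_S c == T)].

Lemma flat_spec z T : T \subset atoms_le z ->
  [/\ top_S (flat z T) <= z, at_S (flat z T) = T
    & forall v, v <= z -> T \subset atoms_le v -> top_S (flat z T) <= v].
Proof.
move=> Tz; have [|u [uz Tu umin]] := @exists_lub z (enum T).
  by move=> t; rewrite mem_enum => /(subsetP Tz); rewrite inE => /andP[].
have iu : in_S rho (u, T).
  rewrite /in_S /= (subset_trans Tz) /=; last by apply/subsetP=> a; rewrite !inE => /andP[].
  apply/bigveeP; split=> [t tT|v vu Tv]; first by rewrite Tu // mem_enum.
  apply/le_anti; rewrite vu umin ?(le_trans vu) // => t.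
  by rewrite mem_enum; apply: Tv.
have lub c : top_S c <= z -> at_S c = T -> top_S c = u.
  move=> cz cT; case/bigveeP: (top_vee c) => Tc cmin.
  apply/esym/cmin; last by move=> t; rewrite cT => tT; rewrite Tu // mem_enum.
  by apply: umin => // t; rewrite mem_enum -cT; apply: Tc.
rewrite /flat; case: pickP => [c /andP[cz /eqP cT] /=|/(_ (exist _ (u, T) iu))].
  split=> // v vz Tv; rewrite (lub c) // umin // => t.
  by rewrite mem_enum => /(subsetP Tv); rewrite inE => /andP[].
by rewrite uz /at_S /= eqxx.
Qed.

Lemma top_flat z T : T \subset atoms_le z -> top_S (flat z T) <= z.
Proof. by move/flat_spec; case. Qed.
Lemma at_flat z T : T \subset atoms_le z -> at_S (flat z T) = T.
Proof. by move/flat_spec; case. Qed.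
Lemma flat_least z T v : v <= z -> T \subset atoms_le v -> top_S (flat z T) <= v.
Proof.
by move=> vz Tv; case: (flat_spec (subset_trans Tv (atoms_leS vz))) => _ _; apply.
Qed.

Lemma flat_eq z c : top_S c <= z -> flat z (at_S c) = c.
Proof.
move=> cz; have [h1 h2 h3] := flat_spec (at_S_le cz).
apply: eq_S => //; case/bigveeP: (top_vee c) => _; apply; last first.
  by move=> t; rewrite -{1}h2; apply: at_le_top.
exact: (h3 _ cz (at_S_le (lexx _))).
Qed.

Lemma flat_flat y z T : y <= z -> T \subset atoms_le y -> flat y T = flat z T.
Proof.
move=> yz Ty; rewrite -[in RHS](at_flat Ty) flat_eq //.
exact: le_trans (top_flat Ty) yz.
Qed.

Lemma le_flat z T c : top_S c <= z -> T \subset atoms_le z ->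
  (c <= flat z T) = (at_S c \subset T).
Proof.
move=> cz Tz; apply/idP/idP=> [/le_at|cT]; first by rewrite at_flat.
rewrite le_SE at_flat // cT andbT -{1}(flat_eq cz); apply: flat_least.
  exact: top_flat.
by rewrite (subset_trans cT) // -{1}(at_flat Tz) at_S_le.
Qed.

Lemma flat_le T c : T \subset at_S c -> flat (top_S c) T <= c.
Proof.
move=> Tc; have Tl := subset_trans Tc (at_S_le (lexx (top_S c))).
by rewrite le_SE top_flat // at_flat.
Qed.

(** Below a fixed element, S is a Boolean lattice: its elements are determined
    and compared by their atom sets. *)
Lemma atomic_le c e z : top_S c <= z -> top_S e <= z -> (c <= e) = (at_S c \subset at_S e).
Proof. by move=> cz ez; rewrite -{1}(flat_eq ez) le_flat // at_S_le. Qed.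

Lemma sdelE c a : sdel c a = flat (top_S c) (at_S c :\ a).
Proof.
rewrite /sdel /flat; congr (odflt _ _); apply: eq_pick => e /=.
rewrite le_SE; case: eqP => [->|]; rewrite ?andbF // subD1set !andbT //.
Qed.

Lemma top_bot_S : top_S (\bot : S) = \bot. Proof. by []. Qed.
Lemma at_bot_S : at_S (\bot : S) = set0. Proof. by []. Qed.

Lemma at_S_eq0 c : (at_S c == set0) = (c == \bot).
Proof.
apply/eqP/eqP => [c0|->//]; rewrite -[c](flat_eq (lexx _)) c0.
by rewrite -at_bot_S flat_eq // le0x.
Qed.

Lemma veeP c e g :
  reflect [/\ c <= g, e <= g & at_S g = at_S c :|: at_S e] (g \in vee c e).
Proof.
have ubP h : reflect (c <= h /\ e <= h) (h \in ubs [set c; e]).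
  rewrite inE; apply: (iffP forall_inP) => [h1|[h1 h2] t].
    by rewrite !h1 // !inE eqxx ?orbT.
  by rewrite !inE => /orP[]/eqP->.
rewrite inE; apply: (iffP andP) => [[/ubP[cg eg] /forall_inP gmin]|[cg eg atg]].
  split=> //; apply/eqP; rewrite eqEsubset subUset !le_at // andbT.
  have su : at_S c :|: at_S e \subset at_S g by rewrite subUset !le_at.
  have sl := subset_trans su (at_S_le (lexx (top_S g))).
  pose h := flat (top_S g) (at_S c :|: at_S e).
  have hg : h <= g by exact: flat_le.
  have /gmin : h \in ubs [set c; e].
    by apply/ubP; rewrite !le_flat ?le_top // subsetUl subsetUr.
  by rewrite lt_neqAle hg andbT negbK => /eqP hE; rewrite -{1}hE at_flat ?subxx.
split; first exact/ubP.
apply/forall_inP=> h /ubP[ch eh]; apply/negP=> hg.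
have gh : g <= h.
  by rewrite (atomic_le (lexx _) (le_top (ltW hg))) atg subUset !le_at.
by move: hg; rewrite (le_gtF gh).
Qed.

(** An atom common to both sets spans, below either element, the same nonzero
    element of S. *)
Lemma wedge_disjoint c e : (wedge c e == [set \bot]) = [disjoint at_S c & at_S e].
Proof.
have lbP h : reflect (h <= c /\ h <= e) (h \in lbs [set c; e]).
  rewrite inE; apply: (iffP forall_inP) => [h1|[h1 h2] t].
    by rewrite !h1 // !inE eqxx ?orbT.
  by rewrite !inE => /orP[]/eqP->.
apply/idP/idP=> [/eqP w0|dce].
  rewrite -setI_eq0; apply/set0Pn => -[a /setIP[ac ae]].
  have aA : a \in atoms rho := subsetP (at_S_sub c) _ ac.
  have a1 : [set a] \subset atoms_le a by rewrite sub1set inE aA lexx.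
  have as1 : at_S (flat a [set a]) = [set a] by rewrite at_flat.
  have lea h : a \in at_S h -> flat a [set a] <= h.
    by move=> ah; rewrite (@flat_flat _ (top_S h)) ?at_le_top // flat_le // sub1set.
  have lbs1 : flat a [set a] \in lbs [set c; e] by apply/lbP; rewrite !lea.
  have : \bot \in wedge c e by rewrite w0 set11.
  rewrite inE => /andP[_ /forall_inP/(_ _ lbs1)].
  by rewrite lt0x -at_S_eq0 as1 -card_gt0 cards1.
apply/eqP/setP=> h; rewrite inE in_set1; apply/andP/eqP=> [[hl _]|->].
  have /lbP[hc he] := hl.
  apply/eqP; rewrite -at_S_eq0 -subset0.
  by move: dce; rewrite -setI_eq0 => /eqP <-; rewrite subsetI !le_at.
split; first by apply/lbP; rewrite !le0x.
apply/forall_inP=> v /lbP[vc ve]; rewrite lt0x negbK -at_S_eq0 -subset0.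
by move: dce; rewrite -setI_eq0 => /eqP <-; rewrite subsetI !le_at.
Qed.

(** The rank inequality from which all the matroid theory of S follows. *)
Lemma rank_flatU1 z a T : a |: T \subset atoms_le z ->
  (rho (top_S (flat z (a |: T))) <= (rho (top_S (flat z T))).+1)%N.
Proof.
rewrite subUset sub1set => /andP[az Tz].
have [aA alz] : a \in atoms rho /\ a <= z by move: az; rewrite inE => /andP.
have [j [jz xj aj jmin]] := lsm_join lsm (top_flat Tz) alz.
move: (aA); rewrite inE => /eqP a1 /(_ a1); apply: leq_trans.
apply/rank_le_mono/flat_least => //.
rewrite subUset sub1set inE aA aj /=.
by rewrite -{1}(at_flat Tz) at_S_le.
Qed.

Lemma rank_sdel c a : a \in at_S c -> (rho (top_S c) <= (rho (top_S (sdel c a))).+1)%N.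
Proof.
move=> ac; rewrite sdelE -{1}(flat_eq (lexx (top_S c))) -{1}(setD1K ac).
by apply: rank_flatU1; rewrite setD1K // at_S_le.
Qed.

Lemma at_sdel c a : at_S (sdel c a) = at_S c :\ a.
Proof.
rewrite sdelE at_flat // (subset_trans (subsetDl _ _)) //.
exact: at_S_le.
Qed.

Lemma sdel_le c a : sdel c a <= c.
Proof. by rewrite sdelE flat_le // subD1set. Qed.

Lemma rank_le_card c : (rho (top_S c) <= #|at_S c|)%N.
Proof.
have [n] := ubnP #|at_S c|; elim: n c => // n IH c.
have [c0 _|/set0Pn[a ac]] := eqVneq (at_S c) set0.
  by move/eqP: c0; rewrite at_S_eq0 => /eqP->; rewrite top_bot_S; case: rk => _ ->.
rewrite (cardsD1 a) ac add1n ltnS => le; apply: leq_trans (rank_sdel ac) _.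
by rewrite ltnS -at_sdel IH // at_sdel.
Qed.

Lemma indep_sdel c a : indep c -> indep (sdel c a).
Proof.
rewrite /indep => /eqP ic; have [ac|nac] := boolP (a \in at_S c); last first.
  have -> : sdel c a = c.
    rewrite sdelE (_ : _ :\ a = at_S c) ?flat_eq //.
    by apply/setDidPl; rewrite disjoint_sym disjoints1.
  by rewrite -/(top_S _) ic.
rewrite eqn_leq rank_le_card at_sdel -ltnS.
have := rank_sdel ac; rewrite {1}/top_S ic (cardsD1 a) ac add1n.
exact: leq_trans.
Qed.

Lemma sdel_flat z T a : T \subset atoms_le z -> sdel (flat z T) a = flat z (T :\ a).
Proof.
move=> Tz; rewrite sdelE at_flat // (@flat_flat _ z) ?top_flat //.
by rewrite -{1}(at_flat Tz) (subset_trans (subD1set _ _)) // at_S_le.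
Qed.

Lemma indep_le c e : c <= e -> indep e -> indep c.
Proof.
have [n] := ubnP #|at_S e|; elim: n e => // n IH e le ce ie.
have [eq_at|/subsetPn[a ae nac]] := boolP (at_S e \subset at_S c).
  suff -> : c = e by []; apply/le_anti; rewrite ce.
  by rewrite (atomic_le (lexx _) (le_top ce)).
apply: (IH (sdel e a)); last exact: indep_sdel.
  by rewrite at_sdel; move: le; rewrite (cardsD1 a) ae ltnS.
rewrite sdelE le_flat ?le_top // ?subsetD1 ?le_at //.
by rewrite (subset_trans (subD1set _ _)) // at_S_le.
Qed.

End LocalSemimodular.

(** * Circuits and nullity *)

Section Circuits.
Context (d : Order.disp_t) (P : finBPOrderType d) (rho : P -> nat).
Local Open Scope order_scope.
Hypothesis lsm : local_semimodular rho.
Local Notation S := (Sp rho).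
Implicit Types (c e w z : S) (a : P).

(** The elements with exactly one circuit below them, by [unicircularP] and
    [nullity1_unicircular]. *)
Definition nullity1 w : bool := #|at_S w| == (rho (top_S w)).+1.

Lemma indepE c : indep c = (rho (top_S c) == #|at_S c|). Proof. by []. Qed.

Lemma rank_sdel_le c a : (rho (top_S (sdel c a)) <= rho (top_S c))%N.
Proof. exact/(rank_le_mono lsm)/le_top/(sdel_le lsm). Qed.

Lemma nullity1_dep w : nullity1 w -> ~~ indep w.
Proof. by move=> /eqP nw; rewrite indepE nw neq_ltn ltnSn. Qed.

(** A dependent element has smaller rank than its number of atoms, so the
    independent rest already has full rank. *)
Lemma top_sdel_indep w a : ~~ indep w -> a \in at_S w -> indep (sdel w a) ->
  top_S (sdel w a) = top_S w.
Proof.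
move=> dw aw; rewrite !indepE (at_sdel lsm) => /eqP iw.
apply: (rank_inj_le lsm); first exact/le_top/(sdel_le lsm).
apply/eqP; rewrite eqn_leq rank_sdel_le iw -ltnS.
have -> : (#|at_S w :\ a|.+1 = #|at_S w|)%N by rewrite (cardsD1 a (at_S w)) aw.
by rewrite ltn_neqAle -indepE dw (rank_le_card lsm).
Qed.

Lemma nullity1_sdel w a : ~~ indep w -> a \in at_S w -> indep (sdel w a) ->
  nullity1 w.
Proof.
move=> dw aw iw; rewrite /nullity1; move: (iw).
rewrite indepE (top_sdel_indep dw) // => /eqP ->.
by rewrite (at_sdel lsm) (cardsD1 a (at_S w)) aw.
Qed.

Lemma sdel_mono c e a : c <= e -> sdel c a <= sdel e a.
Proof.
move=> ce; rewrite (atomic_le lsm (z := top_S e)).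
- by rewrite !(at_sdel lsm) setSD // le_at.
- exact: le_trans (le_top (sdel_le lsm c a)) (le_top ce).
- exact: le_top (sdel_le lsm e a).
Qed.

Lemma sdel_id c a : a \notin at_S c -> sdel c a = c.
Proof.
move=> nac; rewrite sdelE (_ : _ :\ a = at_S c) ?(flat_eq lsm) //.
by apply/setDidPl; rewrite disjoint_sym disjoints1.
Qed.

Lemma le_sdel c e a : c <= e -> a \notin at_S c -> c <= sdel e a.
Proof. by move=> ce nac; rewrite -(sdel_id nac) sdel_mono. Qed.

Lemma circuit_indep_sdel z a : circuit z -> a \in at_S z -> indep (sdel z a).
Proof.
move=> /andP[dz /forall_inP zmin] az; apply: zmin.
rewrite lt_neqAle (sdel_le lsm) andbT; apply/eqP=> /(congr1 (fun c => a \in at_S c)).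
by rewrite (at_sdel lsm) !inE eqxx az.
Qed.

Lemma exists_circuit w : ~~ indep w -> exists2 z, circuit z & z <= w.
Proof.
move=> dw; have w0 : ~~ indep w && (w <= w) by rewrite dw lexx.
case: (@arg_minnP _ w (fun z => ~~ indep z && (z <= w)) (fun z => #|at_S z|) w0).
move=> z /andP[dz zw] zmin; exists z => //; rewrite /circuit dz.
apply/forall_inP=> e ez; apply: contraT => de.
have := zmin e; rewrite de (le_trans (ltW ez)) // => /(_ isT) le.
have /eqP eqat : at_S e == at_S z by rewrite eqEcard le le_at // ltW.
suff ezE : e = z by rewrite ezE ltxx in ez.
apply/le_anti; rewrite (ltW ez).
by rewrite (atomic_le lsm (lexx _) (le_top (ltW ez))) eqat subxx.
Qed.

Lemma top_sdel_circuit z w a : circuit z -> z <= w -> a \in at_S z ->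
  top_S (sdel w a) = top_S w.
Proof.
move=> cz zw az; have dz : ~~ indep z by case/andP: cz.
apply/le_anti; rewrite le_top ?(sdel_le lsm) //=.
rewrite -{1}(flat_eq lsm (lexx (top_S w))); apply: (flat_least lsm).
  exact/le_top/(sdel_le lsm).
have aw : a \in at_S w by exact: subsetP (le_at zw) _ az.
rewrite -{1}(setD1K aw) subUset -(at_sdel lsm) at_S_le // andbT sub1set inE.
rewrite (subsetP (at_S_sub w)) //=; apply: (le_trans (at_le_top az)).
rewrite -(top_sdel_indep dz az); last exact: circuit_indep_sdel.
exact/le_top/sdel_mono.
Qed.

(** Deleting an atom outside the circuit [z] leaves an element above [z], hence
    dependent. Deleting an atom of [z] leaves an independent element, since a
    circuit below it would be a second circuit below [w]. *)
Lemma unicircularP z w : unicircular z w ->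
  nullity1 w /\ at_S z = [set a in at_S w | indep (sdel w a)].
Proof.
case/and3P=> cz zw /forallP uz.
have indz a : a \in at_S z -> indep (sdel w a).
  move=> az; apply: contraT => /exists_circuit[c cc csw].
  have := uz c; rewrite cc (le_trans csw) ?(sdel_le lsm) //= => /eqP cE.
  have := subsetP (le_at csw) a; rewrite cE az (at_sdel lsm) !inE eqxx.
  by move=> /(_ isT).
have dw : ~~ indep w by apply: contra (proj1 (andP cz)) => /(indep_le lsm zw).
split.
  have /set0Pn[a az] : at_S z != set0.
    apply: contra (proj1 (andP cz)) => z0; rewrite indepE (eqP z0) cards0.
    move: z0; rewrite (at_S_eq0 lsm) => /eqP ->; rewrite top_bot_S.
    by rewrite (rank_eq0 lsm).
  by apply: (nullity1_sdel dw) (indz _ az); apply: subsetP (le_at zw) _ az.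
apply/setP=> a; rewrite inE; apply/idP/andP=> [az|[aw ia]].
  by split; [apply: subsetP (le_at zw) _ az | apply: indz].
apply: contraT => naz; case/andP: cz => /negP[].
by apply: (indep_le lsm) ia; apply: le_sdel.
Qed.

(** Two circuits below [w] would differ by an atom; deleting it leaves an
    independent set which contains one of them. *)
Lemma nullity1_unicircular w : nullity1 w -> exists z, unicircular z w.
Proof.
move=> nw; have [z cz zw] := exists_circuit (nullity1_dep nw).
exists z; rewrite /unicircular cz zw; apply/forall_inP=> c /andP[cc cw].
have ind a : a \in at_S z -> indep (sdel w a).
  move=> az; rewrite indepE (top_sdel_circuit cz) // -eqSS -(eqP nw).
  by rewrite (at_sdel lsm) (cardsD1 a (at_S w)) (subsetP (le_at zw)).
have sub : at_S z \subset at_S c.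
  apply/subsetP=> a az; apply: contraT => nac; case/andP: cc => /negP[].
  by apply: (indep_le lsm) (ind a az); apply: le_sdel.
have zc : z <= c.
  by rewrite (atomic_le lsm (le_top zw) (le_top cw)).
rewrite eq_sym; move: zc; rewrite le_eqVlt => /orP[//|zc].
by case/andP: cc => _ /forall_inP/(_ _ zc); case/andP: cz => /negPf->.
Qed.

Lemma indep_bot : indep (\bot : S).
Proof. by rewrite indepE top_bot_S at_bot_S cards0 (rank_eq0 lsm). Qed.

End Circuits.

(** * Functions on a finite set, and linear quotients *)

Section FunSpace.
Variable T : finType.
Implicit Types (X Y : {set T}) (t u : T).

Definition funsp : vectType rat := {ffun T -> rat^o}.
Implicit Type v : funsp.

Definition delta t : funsp := [ffun u => (u == t)%:R].

Lemma deltaE t u : delta t u = (u == t)%:R.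
Proof. by rewrite ffunE. Qed.

Lemma funsp0 t : (0 : funsp) t = 0.
Proof. by rewrite ffunE. Qed.

Lemma funspD v w t : (v + w) t = v t + w t.
Proof. by rewrite ffunE. Qed.

Lemma funspB v w t : (v - w) t = v t - w t.
Proof. by rewrite !ffunE. Qed.

Lemma funspZ k v t : (k *: v) t = k * v t.
Proof. by rewrite ffunE. Qed.

Lemma funsp_sum (I : Type) (r : seq I) (Q : pred I) (F : I -> funsp) t :
  (\sum_(i <- r | Q i) F i) t = \sum_(i <- r | Q i) F i t.
Proof. by rewrite sum_ffunE. Qed.

Lemma delta_sum v : v = \sum_t v t *: delta t.
Proof.
apply/ffunP=> u; rewrite funsp_sum (bigD1 u) //= big1 => [|t tu].
  by rewrite funspZ deltaE eqxx mulr1 addr0.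
by rewrite funspZ deltaE eq_sym (negPf tu) mulr0.
Qed.

Lemma sum_deltaE (Q : pred T) t : (\sum_(u | Q u) delta u) t = (Q t)%:R.
Proof.
rewrite funsp_sum big_mkcond (bigD1 t) //= big1 => [|u ut].
  by rewrite deltaE eqxx addr0; case: (Q t).
by rewrite deltaE eq_sym (negPf ut) if_same.
Qed.

Lemma sum_scale_deltaE (Q : pred T) (F : T -> rat) t :
  (\sum_(u | Q u) F u *: delta u) t = if Q t then F t else 0.
Proof.
rewrite funsp_sum big_mkcond (bigD1 t) //= big1 => [|u ut].
  by rewrite funspZ deltaE eqxx mulr1 addr0.
by rewrite funspZ deltaE eq_sym (negPf ut) mulr0 if_same.
Qed.

Definition supp_sp X : {vspace funsp} := (\sum_(t in X) <[delta t]>)%VS.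

Lemma supp_spP X v : reflect (forall t, t \notin X -> v t = 0) (v \in supp_sp X).
Proof.
apply: (iffP memv_sumP) => [[f fX -> t tX]|vX].
  rewrite funsp_sum big1 // => u uX; have /vlineP[k ->] := fX _ uX.
  rewrite funspZ deltaE (_ : t == u = false) ?mulr0 //.
  by apply: contraNF tX => /eqP->.
exists (fun t => v t *: delta t) => [t _|]; first by rewrite memvZ // memv_line.
rewrite {1}(delta_sum v) [RHS]big_mkcond; apply: eq_bigr => t _.
by case: ifPn => // /vX ->; rewrite scale0r.
Qed.

Lemma delta_supp X t : (delta t \in supp_sp X) = (t \in X).
Proof.
apply/supp_spP/idP => [h|tX u uX]; last first.
  by rewrite deltaE (_ : u == t = false) //; apply: contraNF uX => /eqP->.
by apply: contraT => /h /eqP; rewrite deltaE eqxx oner_eq0.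
Qed.

Lemma supp_spS X Y : X \subset Y -> (supp_sp X <= supp_sp Y)%VS.
Proof.
move=> /subsetP XY; apply/subvP=> v /supp_spP vX; apply/supp_spP=> t tY.
by apply: vX; apply: contra tY => /XY.
Qed.

Lemma dim_sum_disjoint_supp (I : finType) (Q : pred I) (U : I -> {vspace funsp})
    (X : I -> {set T}) :
  (forall i, Q i -> (U i <= supp_sp (X i))%VS) ->
  (forall i j t, Q i -> Q j -> t \in X i -> t \in X j -> i = j) ->
  \dim (\sum_(i | Q i) U i)%VS = (\sum_(i | Q i) \dim (U i))%N.
Proof.
move=> UX disj; apply/directvP/directv_sum_independent => u uU u0 i Qi.
apply/ffunP=> t; rewrite [RHS]ffunE.
have uX j : Q j -> t \notin X j -> u j t = 0.
  by move=> Qj; apply/supp_spP/(subvP (UX j Qj))/uU.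
have [tX|] := boolP (t \in X i); last exact: uX.
have := congr1 (fun v : funsp => v t) u0; rewrite /= funsp_sum (bigD1 i) //= big1.
  by rewrite addr0 ffunE.
move=> j /andP[Qj ji]; apply: uX => //; apply: contra ji => tXj.
by apply/eqP; apply: disj tX.
Qed.

Lemma dim_supp_sp X : \dim (supp_sp X) = #|X|.
Proof.
rewrite (@dim_sum_disjoint_supp _ _ _ (fun t => [set t])).
- rewrite -sum1_card; apply: eq_bigr => t _; rewrite dim_vline.
  case: eqP => // /ffunP/(_ t)/eqP.
  by rewrite deltaE eqxx ffunE oner_eq0.
- by move=> t _; rewrite -memvE delta_supp set11.
by move=> i j t _ _; rewrite !inE => /eqP<- /eqP<-.
Qed.

Section LinExt.
Variables (W : lmodType rat) (G : T -> W).

Definition lin_ext (v : funsp) : W := \sum_t v t *: G t.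

Fact lin_ext_linear : linear lin_ext.
Proof.
move=> k u v; rewrite /lin_ext scaler_sumr -big_split; apply: eq_bigr => t _ /=.
by rewrite funspD funspZ scalerDl scalerA.
Qed.
HB.instance Definition _ := GRing.isLinear.Build rat funsp W *:%R lin_ext
  lin_ext_linear.

Lemma lin_ext_delta t : lin_ext (delta t) = G t.
Proof.
rewrite /lin_ext (bigD1 t) //= big1 => [|u ut].
  by rewrite deltaE eqxx scale1r addr0.
by rewrite deltaE (negPf ut) scale0r.
Qed.

Lemma lin_ext_comb (I : Type) (r : seq I) (Q : pred I) (F : I -> rat) (H : I -> funsp) :
  lin_ext (\sum_(i <- r | Q i) F i *: H i) = \sum_(i <- r | Q i) F i *: lin_ext (H i).
Proof. by rewrite linear_sum; apply: eq_bigr => i _; rewrite linearZ. Qed.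

End LinExt.

End FunSpace.

Section Quotients.
Variables V A : lmodType rat.
Variable f : {linear V -> A}.
Hypothesis f_surj : forall a, exists v, f v = a.

Lemma first_iso (W : lmodType rat) (g : {linear V -> W}) :
  (forall w, exists v, g v = w) -> (forall v, f v = 0 <-> g v = 0) ->
  exists2 phi : {linear A -> W}, bijective phi & forall v, phi (f v) = g v.
Proof.
move=> g_surj kerE.
pose s a := projT1 (cid (f_surj a)); pose r w := projT1 (cid (g_surj w)).
have sK a : f (s a) = a by rewrite /s; case: cid.
have rK w : g (r w) = w by rewrite /r; case: cid.
have congr u v : f u = f v <-> g u = g v.
  have := kerE (u - v); rewrite !linearB => -[h1 h2].
  by split=> /eqP; rewrite -subr_eq0 => /eqP e; apply/eqP; rewrite -subr_eq0; apply/eqP; tauto.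
have lin : linear (g \o s).
  by move=> k a b; rewrite /= -linearP; apply/congr; rewrite linearP !sK.
pose phi : {linear A -> W} :=
  HB.pack (g \o s) (GRing.isLinear.Build rat A W *:%R (g \o s) lin).
have phiE v : phi (f v) = g v by apply/congr; rewrite sK.
exists phi => //; exists (f \o r) => [a|w]; last exact: etrans (phiE _) (rK w).
by rewrite -[RHS]sK; apply/congr; rewrite rK.
Qed.

End Quotients.

Lemma has_dim_quotient (vT : vectType rat) (A : lmodType rat)
    (f : {linear vT -> A}) (U : {vspace vT}) :
  (forall a, exists v, f v = a) -> (forall v, f v = 0 <-> v \in U) ->
  has_dim A (\dim {:vT} - \dim U).
Proof.
move=> f_surj kerE; rewrite -dimv_compl.
pose n := \dim (U^C)%VS; pose p := daddv_pi (U^C)%VS U.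
pose g v : 'rV[rat]_n := \row_i coord (vbasis U^C) i (p v).
have lin : linear g by move=> k u v; apply/rowP=> i; rewrite !mxE !linearP.
pose gL : {linear vT -> 'rV[rat]_n} :=
  HB.pack g (GRing.isLinear.Build rat vT 'rV[rat]_n *:%R g lin).
have cap0 : (U^C :&: U = 0)%VS by rewrite capvC capv_compl.
have pv v : v = p v + daddv_pi U U^C%VS v.
  by rewrite daddv_pi_add // addvC addv_complf memvf.
have [phi bij_phi _] : exists2 phi : {linear A -> 'rV[rat]_n},
    bijective phi & forall v, phi (f v) = gL v.
  apply: first_iso => // [r|v].
    pose v := \sum_i r 0 i *: (vbasis U^C)`_i.
    have vU : v \in (U^C)%VS.
      by apply: rpred_sum => i _; rewrite memvZ // vbasis_mem // mem_nth // size_tuple.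
    exists v; apply/rowP=> i; rewrite /= !mxE /p daddv_pi_id //.
    by rewrite coord_sum_free // (basis_free (vbasisP _)).
  rewrite kerE; split=> [vU|g0].
    apply/rowP=> i; rewrite /= !mxE (_ : p v = 0) ?linear0 //.
    have : p v \in (U^C :&: U)%VS.
      rewrite memv_cap memv_pi /= -[p v](addrK (daddv_pi U U^C%VS v)) -pv.
      by rewrite memvB // memv_pi.
    by rewrite cap0 memv0 => /eqP.
  rewrite (pv v) (_ : p v = 0) ?add0r ?memv_pi //.
  rewrite (coord_vbasis (memv_pi _ _ v)) big1 // => i _.
  by have := congr1 (fun r : 'rV_n => r 0 i) g0; rewrite /= !mxE => ->; rewrite scale0r.
by exists phi.
Qed.

(** * Multiplication by a generator *)

Section Model.
Context (d : Order.disp_t) (P : finBPOrderType d) (rho : P -> nat) (lo : rel P).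
Hypothesis lsm : local_semimodular rho.
Hypothesis lo_lin : linear_order_on lo (atoms rho).
Local Notation S := (Sp rho).
Local Notation FS := (funsp S).
Local Notation sh := (shuffle lo).
Implicit Types (c e g h w z : S) (a b : P) (y : P) (v : FS).

(** The independent part of the boundary of [w]. For [w] of nullity one its
    terms are indexed by the circuit of [w]. *)
Definition circ w : FS :=
  \sum_(a in at_S w | indep (sdel w a)) sh [set a] (at_S w :\ a) *: delta (sdel w a).

Definition dep_S : {set S} := [set c | ~~ indep c].

Definition circ_sp y : {vspace FS} :=
  (\sum_(w : S | nullity1 w && (top_S w == y)) <[circ w]>)%VS.

(** The relations of the algebra, on the space with basis S: dependent elements
    and circuit relations vanish. *)
Definition rel_sp : {vspace FS} := (supp_sp dep_S + \sum_y circ_sp y)%VS.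

Lemma circ_rel w : nullity1 w -> circ w \in rel_sp.
Proof.
move=> nw; apply: (subvP (addvSr _ _)).
apply: (subvP (sumv_sup (top_S w) _ (subvv _))) => //.
by apply: (subvP (sumv_sup w _ (subvv _))); rewrite ?nw ?eqxx ?memv_line.
Qed.

Lemma dep_rel v : v \in supp_sp dep_S -> v \in rel_sp.
Proof. exact: (subvP (addvSl _ _)). Qed.

Lemma rel_sp_ind (U : {vspace FS}) :
  (forall c, ~~ indep c -> delta c \in U) ->
  (forall w, nullity1 w -> circ w \in U) -> (rel_sp <= U)%VS.
Proof.
move=> Udep Ucirc; rewrite subv_add; apply/andP; split.
  by apply/subv_sumP=> c; rewrite inE -memvE => /Udep.
apply/subv_sumP=> y _; apply/subv_sumP=> w /andP[nw _].
by rewrite -memvE Ucirc.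
Qed.

(** Multiplication by the generator of [g], in coordinates: the coefficient at
    [c] is read off at the complement of [g] in the Boolean lattice below [c]. *)
Definition mul_gen g v : FS := [ffun c : S => if indep c && (g <= c)%O then
  sh (at_S g) (at_S c :\: at_S g) * v (flat rho (top_S c) (at_S c :\: at_S g)) else 0].

Fact mul_gen_linear g : linear (mul_gen g).
Proof.
move=> k u v; apply/ffunP=> c; rewrite funspD funspZ !ffunE.
case: ifP => _; last by rewrite mulr0 addr0.
by rewrite mulrDr; congr (_ + _); apply: mulrCA.
Qed.
HB.instance Definition _ g := GRing.isLinear.Build rat FS FS *:%R (mul_gen g)
  (mul_gen_linear g).

Lemma setD_atoms_le c (A : {set P}) : at_S c :\: A \subset atoms_le rho (top_S c).
Proof. exact: subset_trans (subsetDl _ _) (at_S_le (lexx _)). Qed.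

Lemma vee_disjointP g c e : reflect (g <= e /\ flat rho (top_S e) (at_S e :\: at_S g) = c)%O
  ([disjoint at_S g & at_S c] && (e \in vee g c)).
Proof.
apply: (iffP andP) => [[dgc /(veeP lsm)[ge ce ate]]|[ge <-]].
  split=> //; rewrite -[RHS](flat_eq lsm (le_top ce)); congr (flat _ _ _).
  rewrite ate setDUl setDv set0U; apply/setDidPl.
  by rewrite disjoint_sym.
rewrite !(at_flat lsm) ?setD_atoms_le //; split.
  by rewrite -setI_eq0 setIDA setDIl setDv set0I.
apply/(veeP lsm); split=> //; first by apply: (flat_le lsm); apply: subsetDl.
rewrite (at_flat lsm) ?setD_atoms_le // setDE setUIr setUCr setIT.
by apply/esym/setUidPr; apply: le_at.
Qed.

Lemma mul_gen_delta g c : mul_gen g (delta c) =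
  if [disjoint at_S g & at_S c] then
    sh (at_S g) (at_S c) *: \sum_(e in vee g c | indep e) delta e else 0.
Proof.
apply/ffunP=> e; rewrite ffunE deltaE.
have h := vee_disjointP g c e.
have [dgc|ndgc] := boolP [disjoint at_S g & at_S c]; last first.
  rewrite (negPf ndgc) in h; rewrite funsp0; case: andP => // -[_ ge].
  case: eqP => [E|]; last by rewrite mulr0.
  by have /h := conj ge E.
rewrite dgc /= in h; rewrite funspZ sum_deltaE.
have [ie|] := boolP (indep e); last by rewrite andbF mulr0.
case: h => [[ge E]|nh]; rewrite ?andbT /=.
  by rewrite ge E eqxx -E (at_flat lsm) ?setD_atoms_le.
rewrite mulr0; case: ifP => // ge; case: eqP => [E|]; rewrite ?mulr0 //.
by case: nh.
Qed.

Lemma mul_gen_bot v c : indep c -> mul_gen \bot%O v c = v c.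
Proof.
move=> ic; rewrite ffunE ic le0x at_bot_S setD0 shuffle0l mul1r.
by rewrite (flat_eq lsm).
Qed.

Lemma shuffle_swap c e : [disjoint at_S c & at_S e] ->
  sh (at_S c) (at_S e) = (-1) ^+ (#|at_S c| * #|at_S e|) * sh (at_S e) (at_S c).
Proof. by apply: (shuffleC lo_lin); apply: at_S_sub. Qed.

Lemma veeC g c : vee g c = vee c g.
Proof. by rewrite /vee setUC. Qed.

Lemma mul_gen_deltaC g c :
  mul_gen g (delta c) = (-1) ^+ (#|at_S g| * #|at_S c|) *: mul_gen c (delta g).
Proof.
rewrite !mul_gen_delta veeC disjoint_sym; case: ifPn => [dcg|_].
  by rewrite scalerA shuffle_swap // disjoint_sym.
by rewrite scaler0.
Qed.

Lemma mul_gen_meet g h v : ~~ [disjoint at_S g & at_S h] -> mul_gen g (mul_gen h v) = 0.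
Proof.
move=> ndgh; apply/ffunP=> c; rewrite funsp0 ffunE.
case: ifP => // /andP[ic gc]; rewrite ffunE.
case: ifP => [/andP[_ /le_at]|]; rewrite ?mulr0 //.
rewrite (at_flat lsm) ?setD_atoms_le // subsetD => /andP[_ dhg].
by rewrite disjoint_sym dhg in ndgh.
Qed.

(** The only join of [g] and [h] below [c] is the one with atom set their union,
    and the signs agree because they count inversions. *)
Lemma mul_gen_join g h v : [disjoint at_S g & at_S h] ->
  mul_gen g (mul_gen h v) =
  sh (at_S g) (at_S h) *: \sum_(c in vee g h | indep c) mul_gen c v.
Proof.
move=> dgh; apply/ffunP=> c; rewrite funspZ funsp_sum ffunE.
have sub e : e \in vee g h -> (e <= c)%O -> (g <= c)%O && (h <= c)%O.
  by move=> /(veeP lsm)[ge he _] ec; rewrite (le_trans ge) // (le_trans he).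
have [/and3P[ic gc hc]|nc] := boolP [&& indep c, g <= c & h <= c]%O; last first.
  rewrite [in RHS]big1 ?mulr0 => [|e /andP[ev ie]]; last first.
    rewrite ffunE; case: ifP => // /andP[ic /(sub _ ev) /andP[gc hc]].
    by rewrite ic gc hc in nc.
  case: ifP => // /andP[ic gc]; rewrite ffunE; case: ifP => [|_]; last by rewrite mulr0.
  move=> /andP[_ hc]; rewrite ic gc (le_trans hc) // in nc.
  by apply: (flat_le lsm); apply: subsetDl.
have ghc : at_S g :|: at_S h \subset at_S c by rewrite subUset !le_at.
have ghl := subset_trans ghc (at_S_le (lexx (top_S c))).
pose e := flat rho (top_S c) (at_S g :|: at_S h).
have ec : (e <= c)%O by exact: flat_le.
have ate : at_S e = at_S g :|: at_S h by exact: at_flat.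
have ev : e \in vee g h.
  by apply/(veeP lsm); rewrite !(le_flat lsm) ?le_top // subsetUl subsetUr.
rewrite ic gc ffunE.
have hc' : (h <= flat rho (top_S c) (at_S c :\: at_S g))%O.
  by rewrite (le_flat lsm) ?le_top ?setD_atoms_le // subsetD le_at // disjoint_sym.
rewrite hc' (indep_le lsm _ ic) ?(flat_le lsm) ?subsetDl //= (at_flat lsm) ?setD_atoms_le //.
rewrite (@flat_flat _ _ _ lsm _ (top_S c)) ?(top_flat lsm) ?setD_atoms_le //; last first.
  rewrite -[X in X :\: _ \subset _](at_flat lsm (setD_atoms_le c (at_S g))).
  exact: setD_atoms_le.
rewrite (bigD1 e) /=; last by rewrite ev (indep_le lsm ec).
rewrite big1 ?addr0 => [|e' /andP[/andP[e'v _] e'e]]; last first.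
  rewrite ffunE; case: ifP => // /andP[_ e'c]; case/eqP: e'e.
  rewrite -(flat_eq lsm (le_top e'c)); congr flat.
  by case/(veeP lsm): e'v.
rewrite ffunE ic ec ate setDDl /=.
have -> : at_S c :\: at_S g = at_S h :|: (at_S c :\: (at_S g :|: at_S h)).
  apply/setP=> x; rewrite !inE; case: (boolP (x \in at_S h)) => [xh|_] /=; last by rewrite orbF.
  by rewrite (subsetP (le_at hc)) // (disjointFl dgh xh).
have dd (A B : {set P}) : [disjoint B & A :\: B].
  by rewrite -setI_eq0 setIDA setDIl setDv set0I.
have dgh' : [disjoint at_S g & at_S c :\: (at_S g :|: at_S h)].
  by apply: disjointWl (subsetUl _ (at_S h)) (dd _ _).
have dhg' : [disjoint at_S h & at_S c :\: (at_S g :|: at_S h)].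
  by apply: disjointWl (subsetUr (at_S g) _) (dd _ _).
by rewrite shuffleUr // shuffleUl // !mulrA; congr (_ * _); ring.
Qed.

Lemma mul_genC g h v :
  mul_gen g (mul_gen h v) = (-1) ^+ (#|at_S g| * #|at_S h|) *: mul_gen h (mul_gen g v).
Proof.
have [dgh|ndgh] := boolP [disjoint at_S g & at_S h].
  rewrite !mul_gen_join //; last by rewrite disjoint_sym.
  by rewrite scalerA -shuffle_swap // veeC.
by rewrite !mul_gen_meet ?scaler0 // disjoint_sym.
Qed.

Lemma mul_gen_dep g c : ~~ indep c -> mul_gen g (delta c) = 0.
Proof.
move=> dc; rewrite mul_gen_delta; case: ifP => // _.
rewrite big1 ?scaler0 // => e /andP[/(veeP lsm)[_ ce _] ie].
by case/negP: dc; apply: indep_le ie.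
Qed.

(** If [a] is in the circuit of [w], the independent joins of [g] and [w] minus
    [a] are the [e] minus [a], for [e] a join of [g] and [w]: the atom [a] lies
    below each such join since deleting it from [w] keeps the join of [w]. *)
Lemma sum_vee_sdel g w a (F : S -> FS) : nullity1 w -> [disjoint at_S g & at_S w] ->
  a \in at_S w -> indep (sdel w a) ->
  \sum_(e in vee g w | nullity1 e && indep (sdel e a)) F (sdel e a) =
  \sum_(c in vee g (sdel w a) | indep c) F c.
Proof.
move=> nw dgw aw iwa; have dw := nullity1_dep nw.
have ag : a \notin at_S g by rewrite (disjointFl dgw aw).
have topw := top_sdel_indep lsm dw aw iwa.
have atE (A B : {set P}) x : x \notin A -> (A :|: B) :\ x = A :|: B :\ x.
  move=> xA; rewrite setDUl; congr (_ :|: _); apply/setDidPl.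
  by rewrite disjoint_sym disjoints1.
(* The inverse of deleting [a] adds [a] back under the same first component. *)
rewrite (reindex_onto (fun c => flat rho (top_S c) (a |: at_S c))
  (fun e => sdel e a)) /=; last first.
  move=> e /and3P[/(veeP lsm)[ge we ate] ne iea].
  have ae : a \in at_S e by rewrite ate inE aw orbT.
  rewrite (at_sdel lsm) setD1K // (top_sdel_indep lsm (nullity1_dep ne) ae iea).
  exact: flat_eq.
apply: eq_big => [c|c /andP[_ /eqP->] //].
apply/idP/idP => [/andP[/and3P[]]|/andP[/(veeP lsm)[gc wc atc] ic]].
  set e := flat _ _ _ => /(veeP lsm)[ge we ate] ne iea /eqP cE.
  rewrite -cE iea andbT; apply/(veeP lsm); rewrite (sdel_mono lsm) //.
  by rewrite (le_sdel lsm) // !(at_sdel lsm) ate atE.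
have wtop : (top_S w <= top_S c)%O by rewrite -topw le_top.
have alec : a |: at_S c \subset atoms_le rho (top_S c).
  rewrite subUset at_S_le // andbT sub1set inE (subsetP (at_S_sub w)) //=.
  exact: le_trans (at_le_top aw) wtop.
set e := flat _ _ _.
have ate : at_S e = at_S g :|: at_S w.
  by rewrite (at_flat lsm) // atc (at_sdel lsm) setUCA setD1K.
have we : (w <= e)%O.
  by rewrite (le_flat lsm) // -(at_flat lsm alec) -/e ate subsetUr.
have cE : sdel e a = c.
  rewrite (sdel_flat lsm) // -[RHS](flat_eq lsm (lexx _)); congr flat.
  apply/setP=> x; rewrite !inE; case: eqP => //= ->.
  by apply/esym/negbTE; rewrite atc (at_sdel lsm) !inE eqxx /= orbF.
have de : ~~ indep e by apply: contra dw; apply: indep_le.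
have ae : a \in at_S e by rewrite ate inE aw orbT.
rewrite cE ic eqxx !andbT (nullity1_sdel lsm de ae) ?cE // andbT.
apply/(veeP lsm); split=> //.
by rewrite (le_flat lsm) ?le_top // -(at_flat lsm alec) -/e ate subsetUl.
Qed.

(** If [g] and [w] have disjoint atom sets, the product is, up to sign, the sum
    of the circuit relations of their joins of nullity one, by [sum_vee_sdel].
    Otherwise it vanishes, since a nonzero term would come from an independent
    element above [w]. *)
Lemma mul_gen_circ g w : nullity1 w -> mul_gen g (circ w) \in rel_sp.
Proof.
move=> nw; have dw := nullity1_dep nw; rewrite /circ linear_sum.
have [dgw|ndgw] := boolP [disjoint at_S g & at_S w]; last first.
  rewrite big1 ?mem0v // => a /andP[aw iwa].
  rewrite linearZ /= mul_gen_delta; case: ifP => [dga|]; rewrite ?scaler0 //.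
  rewrite big1 ?scaler0 // => e /andP[/(veeP lsm)[ge we ate] ie].
  case/negP: (dw); apply: (indep_le lsm) ie => //.
  rewrite le_SE -(top_sdel_indep lsm dw aw iwa) le_top //=.
  have [b bg bw] : exists2 b, b \in at_S g & b \in at_S w.
    by move: ndgw; rewrite -setI_eq0 => /set0Pn[b /setIP[bg bw]]; exists b.
  have ab : a = b.
    apply/eqP; apply: contraFT (disjointFr dga bg) => nab.
    by rewrite (at_sdel lsm) !inE eq_sym nab.
  rewrite ate (at_sdel lsm) -[at_S w](setD1K aw) setU1K ?setD11 //.
  by rewrite setSU // sub1set ab.
suff -> : \sum_(a in at_S w | indep (sdel w a))
     mul_gen g (sh [set a] (at_S w :\ a) *: delta (sdel w a)) =
   ((-1) ^+ #|at_S g| * sh (at_S g) (at_S w)) *: \sum_(e in vee g w | nullity1 e) circ e.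
  by apply/memvZ/memv_suml => e /andP[_ ne]; apply: circ_rel.
rewrite scaler_sumr.
have -> : \sum_(e in vee g w | nullity1 e) ((-1) ^+ #|at_S g| * sh (at_S g) (at_S w)) *: circ e
  = \sum_(e in vee g w | nullity1 e) \sum_(a in at_S w | indep (sdel w a))
    if indep (sdel e a) then
    (sh [set a] (at_S w :\ a) * sh (at_S g) (at_S w :\ a)) *: delta (sdel e a) else 0.
  apply: eq_bigr => e /andP[/(veeP lsm)[ge we ate] ne].
  rewrite /circ scaler_sumr [LHS]big_mkcond [RHS]big_mkcond /=; apply: eq_bigr => a _.
  have [iea|diea] := boolP (indep (sdel e a)); last by rewrite andbF if_same.
  have iwa : indep (sdel w a) by apply: (indep_le lsm) iea; apply: sdel_mono.
  rewrite iwa !andbT ate inE; have [aw|naw] := boolP (a \in at_S w); last first.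
    rewrite orbF; case: ifP => // ag; case/negP: dw.
    by apply: (indep_le lsm) iea; apply: le_sdel.
  have ag : a \notin at_S g by rewrite (disjointFl dgw aw).
  rewrite orbT scalerA; congr (_ *: _).
  have -> : (at_S g :|: at_S w) :\ a = at_S g :|: (at_S w :\ a).
    rewrite setDUl; congr (_ :|: _); apply/setDidPl.
    by rewrite disjoint_sym disjoints1.
  have dga : [disjoint at_S g & at_S w :\ a] by apply: disjointWr (subD1set _ _) dgw.
  have sA : [set a] \subset atoms rho by rewrite sub1set (subsetP (at_S_sub w)).
  have swap : sh (at_S g) [set a] = (-1) ^+ #|at_S g| * sh [set a] (at_S g).
    by rewrite (shuffleC lo_lin) ?at_S_sub ?cards1 ?muln1 // disjoint_sym disjoints1.
  rewrite shuffleUr // -{1}[at_S w](setD1K aw) shuffleUr ?disjoints1 ?setD11 // swap.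
  have sK : (-1) ^+ #|at_S g| * (-1) ^+ #|at_S g| = 1 :> rat by rewrite -expr2 sqrr_sign.
  have shK := shuffleK lo [set a] (at_S g).
  set s1 := sh [set a] (at_S w :\ a); set s2 := sh (at_S g) (at_S w :\ a).
  move: sK shK; set s3 := _ ^+ _; set s4 := sh [set a] _ => sK shK.
  transitivity ((s3 * s3) * (s4 * s4) * s1 * s2); first by ring.
  by rewrite sK shK !mul1r.
rewrite exchange_big /=; apply: eq_bigr => a /andP[aw iwa].
rewrite linearZ /= mul_gen_delta; have -> : [disjoint at_S g & at_S (sdel w a)].
  by rewrite (at_sdel lsm); apply: disjointWr (subD1set _ _) dgw.
rewrite scalerA (at_sdel lsm) -(sum_vee_sdel _ nw dgw aw iwa) scaler_sumr.
rewrite [LHS]big_mkcond [RHS]big_mkcond /=; apply: eq_bigr => e _.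
by case: (e \in vee g w) => //=; case: (nullity1 e).
Qed.

Lemma mul_gen_rel g v : v \in rel_sp -> mul_gen g v \in rel_sp.
Proof.
suff : (rel_sp <= linfun (mul_gen g) @^-1: rel_sp)%VS.
  by move=> /subvP h /h; rewrite -memv_preim lfunE.
apply: rel_sp_ind => [c dc|w nw]; rewrite -memv_preim lfunE /=.
  by rewrite mul_gen_dep // mem0v.
exact: mul_gen_circ.
Qed.

(** By graded commutativity, the circuit relation of [w] acts on [delta c] as the
    generator of [c] acts on [circ w], up to a sign common to all terms. *)
Lemma circuit_rel z w v : unicircular z w ->
  \sum_(x in at_S z) sgn lo [set x] (at_S (sdel w x)) *: mul_gen (sdel w x) v \in rel_sp.
Proof.
move=> uzw; have [nw ->] := unicircularP lsm uzw.
have -> : \sum_(x in [set a in at_S w | indep (sdel w a)])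
    sgn lo [set x] (at_S (sdel w x)) *: mul_gen (sdel w x) v =
  \sum_c (v c * (-1) ^+ (#|at_S w|.-1 * #|at_S c|)) *: mul_gen c (circ w).
  rewrite {1}[v]delta_sum /circ.
  under [RHS]eq_bigr => c _ do rewrite linear_sum scaler_sumr.
  rewrite [RHS]exchange_big /=; apply: eq_big => [a|a]; rewrite inE // => /andP[aw iwa].
  have aA : a \in atoms rho := subsetP (at_S_sub w) _ aw.
  rewrite (sgn_shuffle lo_lin) ?sub1set ?at_S_sub //; last first.
    by rewrite disjoints1 (at_sdel lsm) setD11.
  rewrite linear_sum scaler_sumr; apply: eq_bigr => c _.
  rewrite !linearZ /= [mul_gen (sdel w a) _]mul_gen_deltaC !scalerA (at_sdel lsm).
  have -> : #|at_S w :\ a| = #|at_S w|.-1 by rewrite (cardsD1 a (at_S w)) aw.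
  by congr (_ *: _); ring.
by apply: memv_suml => c _; apply/memvZ/mul_gen_circ.
Qed.

End Model.

(** * Linear maps on monoid algebras *)

Section LinMalg.
Variables (K : choiceType) (W : lmodType rat) (F : K -> W).

Definition lin_malg (x : {malg rat[K]}) : W := \sum_(k <- msupp x) x@_k *: F k.

Lemma lin_malgw (D : {fset K}) (x : {malg rat[K]}) : (msupp x `<=` D)%fset ->
  lin_malg x = \sum_(k <- D) x@_k *: F k.
Proof.
move=> le; rewrite /lin_malg (big_fset_incl _ le) // => k _ kx.
by rewrite (mcoeff_outdom kx) scale0r.
Qed.

Fact lin_malg_linear : linear lin_malg.
Proof.
move=> c x y; pose D := (msupp x `|` msupp y `|` msupp (c *: x + y))%fset.
rewrite !(@lin_malgw D) ?fsubsetUr //; last first.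
- by rewrite /D -fsetUA fsubsetUl.
- by rewrite /D fsetUAC fsubsetUr.
rewrite scaler_sumr -big_split; apply: eq_bigr => k _.
by rewrite mcoeffD mcoeffZ scalerDl scalerA.
Qed.
HB.instance Definition _ := GRing.isLinear.Build rat {malg rat[K]} W *:%R lin_malg
  lin_malg_linear.

Lemma lin_malgU k : lin_malg << k >> = F k.
Proof. by rewrite (lin_malgw msuppU_le) big_seq_fset1 mcoeffUU scale1r. Qed.

End LinMalg.

Lemma malgU_scale (K : choiceType) (c : rat) (k : K) :
  << c *g k >> = c *: << k >> :> {malg rat[K]}.
Proof. by apply/malgP => k'; rewrite mcoeffZ !mcoeffU mulr_natr. Qed.

Lemma malg_linE (K : choiceType) (x : {malg rat[K]}) :
  x = \sum_(k <- msupp x) x@_k *: << k >>.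
Proof. by rewrite {1}(monalgE x); apply: eq_bigr => k _; apply: malgU_scale. Qed.

(** * The action of the free algebra *)

Section Structure.
Context (d : Order.disp_t) (P : finBPOrderType d) (rho : P -> nat) (lo : rel P).
Hypothesis lsm : local_semimodular rho.
Hypothesis lo_lin : linear_order_on lo (atoms rho).
Local Notation S := (Sp rho).
Local Notation FS := (funsp S).
Local Notation sh := (shuffle lo).
Local Notation OSP := (OS rho lo).
Local Notation freeTP := (freeT rho).
Local Notation mul_gen := (mul_gen lo).
Implicit Types (c e w z : S) (g h : gens rho) (v : FS) (x : freeTP).

(** The action of words, the representation of the free algebra on which the
    relations of the algebra hold modulo [rel_sp]. *)
Definition act_word (s : seq (gens rho)) v : FS :=
  foldr (fun g u => mul_gen (val g) u) v s.

Fact act_word_linear s : linear (act_word s).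
Proof. by move=> k u v; elim: s => //= g s ->; rewrite linearP. Qed.
HB.instance Definition _ s := GRing.isLinear.Build rat FS FS *:%R (act_word s)
  (act_word_linear s).

Lemma act_word_cat s1 s2 v : act_word (s1 ++ s2) v = act_word s1 (act_word s2 v).
Proof. by rewrite /act_word foldr_cat. Qed.

Definition act (v : FS) (x : freeTP) : FS :=
  lin_malg (fun w : {fmonom (gens rho)} => act_word w v) x.
HB.instance Definition _ v := GRing.isLinear.Build rat freeTP FS *:%R (act v)
  (@lin_malg_linear _ _ _).

Lemma actB v x y : act v (x - y) = act v x - act v y.
Proof. exact: linearB. Qed.

Lemma actD v x y : act v (x + y) = act v x + act v y.
Proof. exact: linearD. Qed.

Lemma actZ v k x : act v (k *: x) = k *: act v x.
Proof. exact: linearZ. Qed.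

Lemma act_sum (I : Type) (r : seq I) (Q : pred I) (F : I -> rat) (G : I -> freeTP) v :
  act v (\sum_(i <- r | Q i) F i *: G i) = \sum_(i <- r | Q i) F i *: act v (G i).
Proof. by rewrite linear_sum; apply: eq_bigr => i _; apply: linearZ. Qed.

Lemma actU v (w : {fmonom (gens rho)}) : act v << w >> = act_word w v.
Proof. exact: lin_malgU. Qed.

Lemma act_linear_arg x : linear (fun v => act v x).
Proof.
move=> k u v; rewrite /act /lin_malg scaler_sumr -big_split.
by apply: eq_bigr => w _; rewrite /= linearP scalerDr !scalerA mulrC.
Qed.

Lemma actM v x y : act v (x * y) = act (act v y) x.
Proof.
rewrite malgME linear_sum /= {2}/act /lin_malg; apply: eq_bigr => w1 _.
rewrite linear_sum /= {2}/act /lin_malg linear_sum scaler_sumr /=.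
apply: eq_bigr => w2 _; rewrite malgU_scale !linearZ /= actU scalerA.
by rewrite fmM act_word_cat mulrC.
Qed.

Lemma act_gen v g : act v (tgen g) = mul_gen (val g) v.
Proof. rewrite actU fmU. by []. Qed.

Lemma act1 v : act v 1 = v.
Proof. by rewrite actU fm1. Qed.

Lemma act_comm_rel v x : ideal_of (@graded_comm _ P rho) x -> act v x = 0.
Proof.
move=> Ix; elim: Ix v => {x} [x [g [h ->]] v|v|x y _ IHx _ IHy v|u w x _ IH v].
- rewrite actB (actM v (tgen g)) actZ (actM v (tgen h)) !act_gen.
  by rewrite (mul_genC lsm lo_lin) subrr.
- exact: linear0.
- by rewrite actD IHx IHy addr0.
by rewrite !actM IH; have := act_linear_arg u (-1) 0 0;
  rewrite scaler0 addr0 scaleN1r addNr.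
Qed.

(** The action factors through the free graded-commutative algebra. *)
Definition actE v (y : Defs.freeE rho) : FS := act v (qrepr y).

Lemma actE_pi v x : actE v (Defs.piE x) = act v x.
Proof.
apply/eqP; rewrite -subr_eq0 -linearB /=; apply/eqP/act_comm_rel/idealpP.
exact: qreprB.
Qed.

Lemma piE_surj (y : Defs.freeE rho) : exists x, y = Defs.piE x.
Proof. by exists (qrepr y); rewrite /Defs.piE qreprK. Qed.

Lemma actE_linear v : linear (actE v).
Proof.
move=> k y1 y2; have [x1 ->] := piE_surj y1; have [x2 ->] := piE_surj y2.
by rewrite -linearP !actE_pi linearP.
Qed.
HB.instance Definition _ v := GRing.isLinear.Build rat (Defs.freeE rho) FS *:%R (actE v)
  (actE_linear v).

Lemma actE_mul v y1 y2 : actE v (y1 * y2) = actE (actE v y2) y1.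
Proof.
have [x1 ->] := piE_surj y1; have [x2 ->] := piE_surj y2.
by rewrite -(rmorphM (Defs.piE (rho := rho))) !actE_pi actM.
Qed.
End Structure.

(** * The Orlik-Solomon algebra as a quotient of the space with basis S *)

Section StructureOS.
Context (d : Order.disp_t) (P : finBPOrderType d) (rho : P -> nat) (lo : rel P).
Hypothesis lsm : local_semimodular rho.
Hypothesis lo_lin : linear_order_on lo (atoms rho).
Local Notation S := (Sp rho).
Local Notation FS := (funsp S).
Local Notation sh := (shuffle lo).
Local Notation OSP := (OS rho lo).
Local Notation freeTP := (freeT rho).
Local Notation mul_gen := (mul_gen lo).
Local Notation piE := (@Defs.piE d P rho).
Local Notation piA := (@Defs.piA d P rho lo).
Implicit Types (c e w z : S) (g h : gens rho) (v : FS) (x : freeTP).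

Lemma OS_scaleAr k (a b : OSP) : a * (k *: b) = k *: (a * b).
Proof.
have fB : zmod_morphism (fun b : OSP => a * b) by move=> ? ?; apply: mulrBr.
exact: (rat_linear fB).
Qed.

Lemma piA_lin k (x y : Defs.freeE rho) : piA (k *: x + y) = k *: piA x + piA y.
Proof. by rewrite /Defs.piA linearP. Qed.

Lemma piE_M x y : piE (x * y) = piE x * piE y.
Proof. exact: rmorphM. Qed.

Lemma piA_M (x y : Defs.freeE rho) : piA (x * y) = piA x * piA y.
Proof. exact: rmorphM. Qed.

Lemma piA_sum (I : finType) (Q : pred I) (F : I -> rat) (G : I -> Defs.freeE rho) :
  piA (\sum_(i | Q i) F i *: G i) = \sum_(i | Q i) F i *: piA (G i).
Proof.
rewrite /Defs.piA linear_sum; apply: eq_bigr => i _.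
exact: linearZ.
Qed.

Lemma pi_sum (I : Type) (r : seq I) (Q : pred I) (F : I -> rat) (G : I -> freeTP) :
  piA (piE (\sum_(i <- r | Q i) F i *: G i)) =
  \sum_(i <- r | Q i) F i *: piA (piE (G i)).
Proof.
rewrite /Defs.piA /Defs.piE !linear_sum; apply: eq_bigr => i _.
by rewrite !linearZ.
Qed.

(** The generator [e_c], as an element of the free algebra; the element [\bot],
    which is not a generator, stands for the unit. *)
Definition word_of c : freeTP := if insub c is Some g then tgen g else 1.

Definition eS c : OSP := piA (piE (word_of c)).

Lemma eS_egen c : indep c -> c != \bot%O -> eS c = piA (egen c).
Proof. by move=> ic c0; rewrite /eS /word_of /egen; case: insubP; rewrite ?ic ?c0. Qed.

Lemma eS_bot : eS \bot%O = 1.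
Proof.
rewrite /eS /word_of; case: insubP => [g /andP[_]|_]; first by rewrite eqxx.
by rewrite /Defs.piA /Defs.piE !rmorph1.
Qed.

Lemma eS_gen g : eS (val g) = piA (piE (tgen g)).
Proof. by rewrite /eS /word_of valK. Qed.

Lemma piA_rel y : relJ lo y -> piA y = 0.
Proof.
move=> Jy; rewrite -(raddf0 (@qpi _ _ (relJ lo))).
by apply: qpi_congr; rewrite subr0; apply/idealpP/ideal_gen.
Qed.

(** Dependent elements are sent to zero because they vanish in every product
    computed by [mul_gen]. *)
Definition to_OS : FS -> OSP := lin_ext (fun c => if indep c then eS c else 0).
HB.instance Definition _ := GRing.isLinear.Build rat FS OSP *:%R to_OS
  (@lin_ext_linear _ _ _).

Lemma to_OS_lin k u v : to_OS (k *: u + v) = k *: to_OS u + to_OS v.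
Proof. exact: linearP. Qed.

Lemma to_OS_delta c : to_OS (delta c) = if indep c then eS c else 0.
Proof. exact: lin_ext_delta. Qed.

Lemma to_OS_sum (I : Type) (r : seq I) (Q : pred I) (F : I -> rat) (G : I -> FS) :
  to_OS (\sum_(i <- r | Q i) F i *: G i) = \sum_(i <- r | Q i) F i *: to_OS (G i).
Proof. by rewrite linear_sum; apply: eq_bigr => i _; rewrite linearZ. Qed.

Lemma mul_gen_delta_bot g : mul_gen (val g) (delta \bot%O) = delta (val g).
Proof.
have /andP[ig _] := valP g.
rewrite (mul_gen_deltaC lsm lo_lin) at_bot_S cards0 muln0 expr0 scale1r.
apply/ffunP=> c; have [ic|dc] := boolP (indep c); first exact: mul_gen_bot.
rewrite [LHS]ffunE (negPf dc) /= deltaE; case: eqP => // cE.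
by rewrite cE ig in dc.
Qed.

Lemma gens_le_neq0 g c : (val g <= c)%O -> c != \bot%O.
Proof.
by have /andP[_ g0] := valP g; apply: contraTneq => ->; rewrite lex0.
Qed.

Lemma gens_meet g h : ~~ [disjoint at_S (val g) & at_S (val h)] ->
  eS (val g) * eS (val h) = 0.
Proof.
move=> ngh; have /andP[ig g0] := valP g; have /andP[ih h0] := valP h.
rewrite !eS_egen // -piA_M; apply/piA_rel/relJ_meet.
by rewrite (wedge_disjoint lsm).
Qed.

Lemma gens_join g h : [disjoint at_S (val g) & at_S (val h)] ->
  eS (val g) * eS (val h) =
  sh (at_S (val g)) (at_S (val h)) *: \sum_(c in vee (val g) (val h) | indep c) eS c.
Proof.
move=> dgh; have /andP[ig g0] := valP g; have /andP[ih h0] := valP h.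
have /(relJ_join lo)/piA_rel : wedge (val g) (val h) = [set \bot%O].
  by apply/eqP; rewrite (wedge_disjoint lsm).
rewrite [egen _ * _ - _]addrC -scaleNr piA_lin piA_M scaleNr addrC => /eqP.
rewrite subr_eq0 !eS_egen // (sgn_shuffle lo_lin) ?at_S_sub // => /eqP ->.
congr (_ *: _); rewrite -[RHS]scale1r scaler_sumr.
under eq_bigr => c _ do rewrite -[egen c]scale1r.
rewrite piA_sum; apply: eq_bigr => c /andP[/(veeP lsm)[gc _ _] ic].
by rewrite eS_egen // (gens_le_neq0 gc).
Qed.

(** The meet and join relations say that products of generators are computed by
    [mul_gen]. *)
Lemma to_OS_mul_gen g v : to_OS (mul_gen (val g) v) = eS (val g) * to_OS v.
Proof.
have /andP[ig g0] := valP g.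
rewrite [v]delta_sum linear_sum !linear_sum mulr_sumr; apply: eq_bigr => c _.
rewrite !linearZ /= OS_scaleAr; congr (_ *: _); rewrite [in RHS]to_OS_delta.
have [ic|dc] := boolP (indep c); last by rewrite (mul_gen_dep lo lsm _ dc) linear0 mulr0.
have [->|c0] := eqVneq c \bot%O.
  by rewrite mul_gen_delta_bot to_OS_delta ig eS_bot mulr1.
have pc : indep c && (c != \bot%O) by rewrite ic.
have -> : c = val (exist _ c pc : gens rho) by [].
set h := exist _ c pc; rewrite (mul_gen_delta lo lsm).
case: ifPn => [dgh|ngh]; last by rewrite linear0 gens_meet.
rewrite gens_join // linearZ linear_sum /=; congr (_ *: _).
by apply: eq_bigr => e /andP[_ ie]; rewrite to_OS_delta ie.
Qed.

Lemma to_OS_act_word (s : seq (gens rho)) :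
  to_OS (act_word lo s (delta \bot%O)) = \prod_(g <- s) eS (val g).
Proof.
elim: s => [|g s IH]; first by rewrite big_nil to_OS_delta (indep_bot lsm) eS_bot.
by rewrite big_cons -IH -to_OS_mul_gen.
Qed.

Lemma pi_word (s : seq (gens rho)) :
  piA (piE << FMonom s >>) = \prod_(g <- s) eS (val g).
Proof.
elim: s => [|g s IH].
  have -> : FMonom [::] = mone :> {fmonom (gens rho)} by rewrite -fmoneE.
  by rewrite big_nil /Defs.piA /Defs.piE !rmorph1.
have -> : FMonom (g :: s) = mmul (fmu g) (FMonom s) :> {fmonom (gens rho)}.
  by apply/eqP; rewrite fmP fmM fmU.
have -> : << mmul (fmu g) (FMonom s) >> = tgen g * << FMonom s >> :> freeTP.
  by apply/malgP=> k; rewrite malgM_def fgmulUU mulr1.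
by rewrite big_cons -IH piE_M piA_M eS_gen.
Qed.

Lemma to_OS_act x : to_OS (act lo (delta \bot%O) x) = piA (piE x).
Proof.
rewrite [in RHS](malg_linE x) pi_sum /act /lin_malg to_OS_sum; apply: eq_bigr => w _.
by rewrite to_OS_act_word -pi_word fmK.
Qed.

Lemma to_OS_surj a : exists v, to_OS v = a.
Proof.
exists (act lo (delta \bot%O) (qrepr (qrepr a))).
by rewrite to_OS_act /Defs.piA /Defs.piE !qreprK.
Qed.

Lemma sdel_nullity1_neq0 w a : nullity1 w -> a \in at_S w -> sdel w a != \bot%O.
Proof.
move=> nw aw; apply/eqP => /(congr1 (@at_S _ _ _)); rewrite (at_sdel lsm) at_bot_S => w0.
have cw : #|at_S w| = 1%N by rewrite (cardsD1 a) aw w0 cards0.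
move: nw; rewrite /nullity1 cw eqSS eq_sym (rank_eq0 lsm) => /eqP tw.
have := subsetP (at_S_sub w) a aw; rewrite inE.
have := at_le_top aw; rewrite tw lex0 => /eqP->.
by have := rank_eq0 lsm \bot%O; rewrite eqxx => /eqP->.
Qed.

(** Nullity one makes [w] unicircular, and the relation of [w] in the algebra is
    the image of [circ lo w]. *)
Lemma to_OS_circ w : nullity1 w -> to_OS (circ lo w) = 0.
Proof.
move=> nw; have [z uzw] := nullity1_unicircular lsm nw.
have [_ atz] := unicircularP lsm uzw.
have /piA_rel := relJ_circuit lo uzw; rewrite piA_sum => <-.
rewrite /circ to_OS_sum; apply: eq_big => [a|a /andP[aw iwa]].
  by rewrite atz inE.
have -> : sgn lo [set a] (at_S (sdel w a)) = sh [set a] (at_S w :\ a).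
  rewrite (sgn_shuffle lo_lin) ?at_S_sub ?(at_sdel lsm) //.
    by rewrite sub1set (subsetP (at_S_sub w)).
  by rewrite disjoints1 setD11.
by rewrite to_OS_delta iwa (eS_egen iwa (sdel_nullity1_neq0 nw aw)).
Qed.

Lemma to_OS_rel v : v \in rel_sp rho lo -> to_OS v = 0.
Proof.
case/memv_addP => u1 /supp_spP u1d [u2 /memv_sumP[f fc ->] ->].
rewrite linearD linear_sum /= big1 ?addr0 => [|y _].
  rewrite (delta_sum u1) to_OS_sum big1 // => c _; rewrite to_OS_delta.
  have [ic|dc] := boolP (indep c); last by rewrite scaler0.
  by rewrite u1d ?scale0r // inE ic.
have /memv_sumP[h hc ->] := fc y isT; rewrite linear_sum big1 // => w wy.
have /vlineP[k ->] := hc w wy; case/andP: wy => nw _.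
by rewrite linearZ /= to_OS_circ // scaler0.
Qed.

(** The elements that send the whole space into [rel_sp] form an ideal, since the
    action preserves [rel_sp]; so it is enough to look at generators of the ideal. *)
Lemma actE_rel v (y : Defs.freeE rho) : ideal_of (relJ lo) y -> actE lo v y \in rel_sp rho lo.
Proof.
have actE_egen u g : actE lo u (egen (val g)) = mul_gen (val g) u.
  by rewrite /egen valK (actE_pi lsm lo_lin) act_gen.
have actE_indep u c : indep c -> c != \bot%O -> actE lo u (egen c) = mul_gen c u.
  move=> ic c0; have pc : indep c && (c != \bot%O) by rewrite ic.
  by rewrite -[c]/(val (exist _ c pc : gens rho)) actE_egen.
have actE_lin (u : FS) k (y1 y2 : Defs.freeE rho) :
    actE lo u (k *: y1 + y2) = k *: actE lo u y1 + actE lo u y2.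
  by have := actE_linear lsm lo_lin u; apply.
have actE0 (u : FS) : actE lo u 0 = 0.
  by have := actE_lin u (-1) 0 0; rewrite scaler0 addr0 scaleN1r addNr.
have actE_sum (u : FS) (I : finType) (Q : pred I) (F : I -> rat) (G : I -> Defs.freeE rho) :
    actE lo u (\sum_(i | Q i) F i *: G i) = \sum_(i | Q i) F i *: actE lo u (G i).
  elim/big_ind2: _ => [//|v1 y1 v2 y2 <- <-|i _].
    by have := actE_lin u 1 y1 y2; rewrite !scale1r.
  by have := actE_lin u (F i) (G i) 0; rewrite actE0 !addr0.
move=> Jy; elim: Jy v => {y} [_ [g h wgh|g h wgh|z w uzw] v|v|y1 y2 _ IH1 _ IH2 v|u1 u2 y _ IH v].
- rewrite (actE_mul lsm lo_lin) !actE_egen (mul_gen_meet lo lsm) ?mem0v //.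
  by rewrite -(wedge_disjoint lsm).
- have dgh : [disjoint at_S (val g) & at_S (val h)] by rewrite -(wedge_disjoint lsm) wgh.
  rewrite addrC -scaleNr actE_lin (actE_mul lsm lo_lin) !actE_egen.
  rewrite (mul_gen_join lo lsm) // (sgn_shuffle lo_lin) ?at_S_sub // scaleNr.
  under [X in actE lo v X]eq_bigr => c _ do rewrite -[egen c]scale1r.
  rewrite actE_sum; set s1 := \sum_(_ in _ | _) _; set s2 := \sum_(_ in _ | _) _.
  suff -> : s1 = s2 by rewrite addNr mem0v.
  apply: eq_bigr => c /andP[/(veeP lsm)[gc _ _] ic].
  by rewrite scale1r actE_indep // (gens_le_neq0 gc).
- rewrite actE_sum; have [nw atz] := unicircularP lsm uzw.
  rewrite (eq_bigr (fun x : P => sgn lo [set x] (at_S (sdel w x)) *: mul_gen (sdel w x) v)).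
    exact: (circuit_rel lsm lo_lin).
  move=> a; rewrite atz inE => /andP[aw iwa].
  by rewrite actE_indep // sdel_nullity1_neq0.
- by rewrite actE0 mem0v.
- have := actE_lin v 1 y1 y2; rewrite !scale1r => ->.
  by apply: rpredD; [exact: IH1 | exact: IH2].
rewrite !(actE_mul lsm lo_lin).
have actE_pres (t : Defs.freeE rho) v' : v' \in rel_sp rho lo -> actE lo v' t \in rel_sp rho lo.
  move=> Kv'; rewrite /actE /act /lin_malg; apply: rpred_sum => s _; apply: rpredZ.
  elim: (s : seq _) => [//|g s' IHs] /=.
  exact: (mul_gen_rel lsm lo_lin).
by apply/actE_pres/IH.
Qed.

Lemma act_word_of c : indep c -> act lo (delta \bot%O) (word_of c) = delta c.
Proof.
move=> ic; rewrite /word_of; case: insubP => [g _ <-|].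
  by rewrite act_gen mul_gen_delta_bot.
by rewrite ic negbK => /eqP->; rewrite act1.
Qed.

(** If [to_OS v] vanishes, the element [x] of the free algebra with the
    coefficients of [v] lies in the ideal, hence acts into [rel_sp]; but on the
    unit [delta \bot] its value is [v], up to dependent elements. *)
Lemma to_OS_eq0 v : to_OS v = 0 <-> v \in rel_sp rho lo.
Proof.
split; last exact: to_OS_rel; move=> Lv0.
pose x : freeTP := \sum_(c | indep c) v c *: word_of c.
have Lx : to_OS v = piA (piE x).
  rewrite [v in LHS]delta_sum to_OS_sum /x pi_sum [RHS]big_mkcond; apply: eq_bigr => c _.
  by rewrite to_OS_delta; case: (indep c); rewrite ?scaler0.
have Kx : act lo (delta \bot%O) x \in rel_sp rho lo.
  rewrite -(actE_pi lsm lo_lin); apply/actE_rel/idealpP.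
  rewrite -[piE x]subr0 -(@qpi_eq _ _ (relJ lo)) -[qpi _ (piE x)]/(piA (piE x)).
  by rewrite -Lx Lv0 raddf0.
have -> : v = (v - act lo (delta \bot%O) x) + act lo (delta \bot%O) x by rewrite subrK.
apply: rpredD => //; apply/dep_rel/supp_spP => c; rewrite inE negbK => ic.
have -> : act lo (delta \bot%O) x = \sum_(c | indep c) v c *: delta c.
  by rewrite /x act_sum; apply: eq_bigr => e ie; rewrite act_word_of.
by rewrite funspB sum_scale_deltaE ic subrr.
Qed.

Definition deg_S (j : nat) : {set S} := [set c | #|at_S c| == j].

Lemma word_of_homog c : indep c -> eS c \in homogOS (lo := lo) #|at_S c|.
Proof.
move=> ic; apply/asboolP; exists (word_of c) => // w.
rewrite /word_of; case: insubP => [g _ <-|].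
  by rewrite msuppU1 inE => /eqP->; rewrite /word_deg fmU big_seq1.
rewrite ic negbK => /eqP->; rewrite msuppU1 inE => /eqP->.
by rewrite /word_deg fm1 big_nil at_bot_S cards0.
Qed.

Lemma homogP j a : reflect (exists2 v, v \in supp_sp (deg_S j) & to_OS v = a)
  (a \in homogOS (lo := lo) j).
Proof.
apply: (iffP (asboolP _)) => [[x hx ->]|[v /supp_spP vj <-]].
  exists (act lo (delta \bot%O) x); last exact: to_OS_act.
  rewrite /act /lin_malg big_seq; apply: rpred_sum => w /hx <-; apply: rpredZ.
  rewrite /word_deg; elim: (w : seq _) => [|g s IH] /=.
    by rewrite delta_supp inE at_bot_S cards0 big_nil.
  rewrite big_cons; apply/supp_spP=> c; rewrite inE => nc.
  rewrite ffunE; case: ifP => // /andP[_ gc].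
  move/supp_spP: IH => -> //; first by rewrite mulr0.
  rewrite inE (at_flat lsm) ?setD_atoms_le //; apply: contra nc => /eqP <-.
  by rewrite /gdeg -(cardsID (at_S (val g)) (at_S c)) (setIidPr (le_at gc)).
suff: to_OS v \in homogOS (lo := lo) j by move/asboolP.
rewrite (delta_sum v) to_OS_sum; apply: rpred_sum => c _.
have [cj|cj] := boolP (c \in deg_S j); last by rewrite vj // scale0r rpred0.
apply: rpredZ; rewrite to_OS_delta; case: ifP => [ic|]; rewrite ?rpred0 //.
by move: cj; rewrite inE => /eqP <-; apply: word_of_homog.
Qed.

End StructureOS.

(** * Euler characteristic and Moebius function *)

Section EulerCharacteristic.
Context (d : Order.disp_t) (P : finBPOrderType d) (rho : P -> nat) (lo : rel P).
Hypothesis lsm : local_semimodular rho.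
Hypothesis lo_lin : linear_order_on lo (atoms rho).
Local Notation S := (Sp rho).
Local Notation FS := (funsp S).
Local Notation sh := (shuffle lo).
Local Notation circ_sp := (circ_sp rho lo).
Implicit Types (c e w : S) (a b : P) (x y : P) (v u : FS) (p : bool).

Definition top_fiber y : {set S} := [set c | indep c && (top_S c == y)].

Lemma circ_fiber w : nullity1 w -> circ lo w \in supp_sp (top_fiber (top_S w)).
Proof.
move=> nw; apply: memv_suml => a /andP[aw iwa]; apply: memvZ.
by rewrite delta_supp inE iwa (top_sdel_indep lsm (nullity1_dep nw) aw iwa) eqxx.
Qed.

Lemma circ_sp_fiber y : (circ_sp y <= supp_sp (top_fiber y))%VS.
Proof. by apply/subv_sumP=> w /andP[nw /eqP<-]; rewrite -memvE circ_fiber. Qed.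

(** The dimension of the top-degree component of the algebra of the lattice of
    elements below [y]. *)
Definition top_dim y : nat := #|top_fiber y| - \dim (circ_sp y).

Lemma top_dimE y : (top_dim y)%:Z = #|top_fiber y|%:Z - (\dim (circ_sp y))%:Z.
Proof. by rewrite -subzn // -dim_supp_sp dimvS // circ_sp_fiber. Qed.

(** The boundary map of the exterior algebra on the atoms. *)
Definition bdry_elt c : FS :=
  \sum_(b in at_S c) sh [set b] (at_S c :\ b) *: delta (sdel c b).

Definition bdry : FS -> FS := lin_ext bdry_elt.
HB.instance Definition _ := GRing.isLinear.Build rat FS FS *:%R bdry
  (@lin_ext_linear _ _ _).

Lemma bdry_comb (I : Type) (r : seq I) (Q : pred I) (F : I -> rat) (H : I -> FS) :
  bdry (\sum_(i <- r | Q i) F i *: H i) = \sum_(i <- r | Q i) F i *: bdry (H i).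
Proof. exact: lin_ext_comb. Qed.

Lemma bdryE v : bdry v = \sum_c v c *: bdry (delta c).
Proof. by rewrite [in LHS](delta_sum v) bdry_comb. Qed.

Lemma bdry_delta c : bdry (delta c) = bdry_elt c.
Proof. exact: lin_ext_delta. Qed.

Lemma shuffle1C a b : a \in atoms rho -> b \in atoms rho -> a != b ->
  sh [set a] [set b] = - sh [set b] [set a].
Proof.
move=> aA bA ab; rewrite (shuffleC lo_lin) ?sub1set //; last by rewrite disjoints1 inE.
by rewrite !cards1 expr1 mulN1r.
Qed.

Lemma shuffle1D a b (A : {set P}) : b \in A ->
  sh [set a] A = sh [set a] [set b] * sh [set a] (A :\ b).
Proof. by move=> bA; rewrite -{1}(setD1K bA) shuffleUr // disjoints1 setD11. Qed.

Lemma sdel_sdelC c a b : sdel (sdel c a) b = sdel (sdel c b) a.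
Proof.
have D (e : P) : at_S c :\ e \subset atoms_le rho (top_S c).
  exact: subset_trans (subD1set _ _) (at_S_le (lexx _)).
rewrite !(sdelE c) !(sdel_flat lsm) //.
by congr (flat _ _ _); apply/setP=> t; rewrite !inE andbCA.
Qed.

Lemma bdry_bdry_delta c : bdry (bdry (delta c)) = 0.
Proof.
pose f a b := sh [set a] (at_S c :\ a) * sh [set b] (at_S c :\ a :\ b).
have fN a b : a \in at_S c -> b \in at_S c -> a != b -> f a b = - f b a.
  move=> ac bc ab; have := subsetP (at_S_sub c); move=> cA.
  have e1 : sh [set a] (at_S c :\ a) = sh [set a] [set b] * sh [set a] (at_S c :\ a :\ b).
    by apply: shuffle1D; rewrite !inE bc andbT eq_sym.
  have e2 : sh [set b] (at_S c :\ b) = sh [set b] [set a] * sh [set b] (at_S c :\ b :\ a).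
    by apply: shuffle1D; rewrite !inE ac andbT.
  have e3 : at_S c :\ b :\ a = at_S c :\ a :\ b by apply/setP=> t; rewrite !inE andbCA.
  by rewrite /f e1 e2 e3 (@shuffle1C a b) ?cA //; ring.
(* The double sum is antisymmetric in [a] and [b], so it equals its opposite. *)
pose X := \sum_(a in at_S c) \sum_(b in at_S c | b != a) f a b *: delta (sdel (sdel c a) b) : FS.
have -> : bdry (bdry (delta c)) = X.
  rewrite bdry_delta /bdry_elt linear_sum; apply: eq_bigr => a ac.
  rewrite linearZ /= bdry_delta /bdry_elt scaler_sumr; apply: eq_big => b.
    by rewrite (at_sdel lsm) !inE andbC.
  by move=> _; rewrite scalerA (at_sdel lsm).
have XN : X = - X.
  rewrite {1}/X (exchange_big_dep (mem (at_S c))) /=; last by move=> a b _ /andP[].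
  rewrite /X -sumrN; apply: eq_bigr => b bc; rewrite -sumrN.
  apply: eq_big => [a|a /andP[ac /andP[_ ba]]]; first by rewrite bc /= eq_sym.
  by rewrite (fN a b ac bc) 1?eq_sym // scaleNr sdel_sdelC.
have : 2%:R *: X = 0 :> FS by rewrite scaler_nat mulr2n {1}XN addNr.
by move/eqP; rewrite scaler_eq0 => /orP[|/eqP].
Qed.

Lemma bdry_bdry v : bdry (bdry v) = 0.
Proof.
rewrite (bdryE v) bdry_comb big1 // => c _.
by rewrite bdry_bdry_delta scaler0.
Qed.

Section Homotopy.
Variables (x a : P).
Hypotheses (aA : a \in atoms rho) (ax : (a <= x)%O).

(** Exterior multiplication by [a]: the join is taken in the lattice of elements
    below [x]. *)
Definition atom_mul_elt c : FS := if (top_S c <= x)%O && (a \notin at_S c) then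
  sh [set a] (at_S c) *: delta (flat rho x (a |: at_S c)) else 0.

Definition atom_mul : FS -> FS := lin_ext atom_mul_elt.
HB.instance Definition _ := GRing.isLinear.Build rat FS FS *:%R atom_mul
  (@lin_ext_linear _ _ _).

Lemma atom_mul_comb (I : Type) (r : seq I) (Q : pred I) (F : I -> rat) (H : I -> FS) :
  atom_mul (\sum_(i <- r | Q i) F i *: H i) = \sum_(i <- r | Q i) F i *: atom_mul (H i).
Proof. exact: lin_ext_comb. Qed.

Lemma atom_mulE v : atom_mul v = \sum_c v c *: atom_mul (delta c).
Proof. by rewrite [in LHS](delta_sum v) atom_mul_comb. Qed.

Lemma atom_mul_delta c : atom_mul (delta c) = atom_mul_elt c.
Proof. exact: lin_ext_delta. Qed.

Lemma atom_mul_atoms_le c : (top_S c <= x)%O -> a |: at_S c \subset atoms_le rho x.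
Proof. by move=> cx; rewrite subUset at_S_le // sub1set inE aA ax. Qed.

Definition below : {set S} := [set c | (top_S c <= x)%O].

Lemma atom_mul_sqr_delta c : atom_mul (atom_mul (delta c)) = 0.
Proof.
rewrite atom_mul_delta /atom_mul_elt; case: ifP => [/andP[cx ac]|]; last by rewrite linear0.
rewrite linearZ /= atom_mul_delta /atom_mul_elt (at_flat lsm) ?atom_mul_atoms_le //.
by rewrite !inE eqxx /= andbF scaler0.
Qed.

Lemma homotopy_delta c : (top_S c <= x)%O ->
  atom_mul (bdry (delta c)) + bdry (atom_mul (delta c)) = delta c.
Proof.
move=> cx; have cA := subsetP (at_S_sub c).
have sx b : (top_S (sdel c b) <= x)%O by apply: le_trans (le_top (sdel_le lsm c b)) cx.
rewrite [in X in X + _]bdry_delta /bdry_elt linear_sum.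
rewrite [in X in _ + X]atom_mul_delta /atom_mul_elt cx /=.
have [ac|nac] := boolP (a \in at_S c) => /=.
  rewrite linear0 addr0 (bigD1 a) //= big1 ?addr0 => [|b /andP[bc ba]].
    rewrite linearZ /= atom_mul_delta /atom_mul_elt sx (at_sdel lsm) !inE eqxx /=.
    by rewrite setD1K // flat_eq // scalerA shuffleK scale1r.
  rewrite linearZ /= atom_mul_delta /atom_mul_elt sx (at_sdel lsm) !inE eq_sym ba ac /=.
  by rewrite scaler0.
rewrite [bdry _]linearZ /= bdry_delta /bdry_elt.
set e := flat rho x (a |: at_S c).
have ate : at_S e = a |: at_S c by rewrite (at_flat lsm) ?atom_mul_atoms_le.
rewrite ate big_setU1 //= scalerDr addrCA.
have eDa : (a |: at_S c) :\ a = at_S c by rewrite setU1K.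
rewrite sdel_flat ?atom_mul_atoms_le // eDa scalerA shuffleK scale1r flat_eq //.
rewrite -[RHS]addr0; congr (_ + _); rewrite scaler_sumr -big_split big1 //= => b bc.
have ab : a != b by apply: contraNneq nac => ->.
rewrite linearZ /= atom_mul_delta /atom_mul_elt sx (at_sdel lsm) !inE (negPf nac) andbF /=.
rewrite sdel_flat ?atom_mul_atoms_le // !scalerA.
have -> : (a |: at_S c) :\ b = a |: (at_S c :\ b).
  by apply/setP=> t; rewrite !inE; case: eqP => // ->; rewrite eq_sym (negPf ab).
rewrite -scalerDl [sh [set a] (at_S c)](shuffle1D _ bc).
rewrite [sh [set b] (a |: _)](shuffle1D _ (setU11 _ _)) setU1K ?inE ?(negPf nac) ?andbF //.
rewrite (shuffle1C aA (cA b bc) ab).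
set s1 := sh _ _; set s2 := sh _ _; set s3 := sh _ _.
have s33 : s3 * s3 = 1 by apply: shuffleK.
have -> : s1 * s2 + - s3 * s2 * (s3 * s1) = s1 * s2 - (s3 * s3) * (s1 * s2) by ring.
by rewrite s33 mul1r subrr scale0r.
Qed.

Definition clifford v : FS := bdry v + atom_mul v.

Fact clifford_linear : linear clifford.
Proof. by move=> k u v; rewrite /clifford !linearP scalerDr addrACA. Qed.
HB.instance Definition _ := GRing.isLinear.Build rat FS FS *:%R clifford
  clifford_linear.

Lemma homotopy v : v \in supp_sp below -> atom_mul (bdry v) + bdry (atom_mul v) = v.
Proof.
move=> /supp_spP vB; rewrite (bdryE v) (atom_mulE v) atom_mul_comb bdry_comb.
rewrite [RHS](delta_sum v) -big_split /=; apply: eq_bigr => c _.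
rewrite -scalerDr.
have [cB|/vB ->] := boolP (c \in below); last by rewrite !scale0r.
by rewrite homotopy_delta //; move: cB; rewrite inE.
Qed.

Lemma atom_mul_sqr v : atom_mul (atom_mul v) = 0.
Proof.
rewrite (atom_mulE v) atom_mul_comb big1 // => c _.
by rewrite atom_mul_sqr_delta scaler0.
Qed.

(** Multiplication by an atom and the boundary satisfy the Clifford relations:
    both square to zero and their anticommutator is the identity. *)
Lemma cliffordK v : v \in supp_sp below -> clifford (clifford v) = v.
Proof.
move=> vB; rewrite -[RHS]homotopy // /clifford !linearD /= bdry_bdry atom_mul_sqr.
by rewrite add0r addr0 addrC.
Qed.

Definition below_par p : {set S} := [set c in below | odd #|at_S c| == p].
Definition dep_par p : {set S} := [set c in below_par p | ~~ indep c].

Lemma bdry_below p v :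
  v \in supp_sp (below_par p) -> bdry v \in supp_sp (below_par (~~ p)).
Proof.
case/memv_sumP=> f fc ->; rewrite linear_sum; apply: memv_suml => c cB.
have /vlineP[k ->] := fc c cB; rewrite linearZ /= bdry_delta memvZ //.
apply: memv_suml => b bc; rewrite memvZ // delta_supp.
move: cB; rewrite !inE => /andP[cx /eqP<-].
rewrite (le_trans (le_top (sdel_le lsm c b)) cx) (at_sdel lsm) /=.
by rewrite (cardsD1 b (at_S c)) bc /= negbK.
Qed.

Lemma atom_mul_elt_below p c : c \in below_par p -> atom_mul_elt c \in supp_sp (below_par (~~ p)).
Proof.
rewrite inE => /andP[]; rewrite inE => cx /eqP pc.
rewrite /atom_mul_elt; case: ifP => [/andP[_ nac]|]; last by rewrite mem0v.
rewrite memvZ // delta_supp !inE top_flat ?at_flat ?atom_mul_atoms_le //.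
by rewrite cardsU1 nac add1n /= pc.
Qed.

Lemma atom_mul_elt_dep p c : c \in dep_par p -> atom_mul_elt c \in supp_sp (dep_par (~~ p)).
Proof.
rewrite inE => /andP[]; rewrite inE => /andP[]; rewrite inE => cx /eqP pc dc.
rewrite /atom_mul_elt; case: ifP => [/andP[_ nac]|]; last by rewrite mem0v.
rewrite memvZ // delta_supp !inE (top_flat lsm) ?(at_flat lsm) ?atom_mul_atoms_le //.
rewrite cardsU1 nac add1n /= pc eqxx /=; apply: contra dc; apply: (indep_le lsm).
by rewrite (le_flat lsm) ?atom_mul_atoms_le // subsetUr.
Qed.

Lemma atom_mul_supp (Q Q' : {set S}) v : (forall c, c \in Q -> atom_mul_elt c \in supp_sp Q') ->
  v \in supp_sp Q -> atom_mul v \in supp_sp Q'.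
Proof.
move=> QQ' /memv_sumP[f fc ->]; rewrite linear_sum; apply: memv_suml => c cQ.
have /vlineP[k ->] := fc c cQ; rewrite linearZ /= atom_mul_delta memvZ //.
exact: QQ'.
Qed.

(** The parity parts of the ideal of the Orlik-Solomon relations in the exterior
    algebra on the atoms below [x]. *)
Definition ideal_par p : {vspace FS} :=
  (supp_sp (dep_par p) + linfun bdry @: supp_sp (dep_par (~~ p)))%VS.

Lemma dep_par_below p : (supp_sp (dep_par p) <= supp_sp (below_par p))%VS.
Proof. by apply/supp_spS/subsetP=> c; rewrite inE => /andP[]. Qed.

Lemma below_parS p : (supp_sp (below_par p) <= supp_sp below)%VS.
Proof. by apply/supp_spS/subsetP=> c; rewrite inE => /andP[]. Qed.

Lemma ideal_par_below p : (ideal_par p <= supp_sp (below_par p))%VS.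
Proof.
rewrite subv_add dep_par_below; apply/subvP=> _ /memv_imgP[u uD ->].
rewrite lfunE /= -[p]negbK; apply/bdry_below.
exact: (subvP (dep_par_below _)).
Qed.

Lemma clifford_below p v : v \in supp_sp (below_par p) ->
  clifford v \in supp_sp (below_par (~~ p)).
Proof.
by move=> vB; rewrite memvD ?bdry_below //; apply: atom_mul_supp vB; apply: atom_mul_elt_below.
Qed.

(** Both [bdry] and [atom_mul] preserve the sum of the dependent elements and their
    boundaries: for a boundary this is the homotopy formula. *)
Lemma clifford_ideal p v : v \in ideal_par p -> clifford v \in ideal_par (~~ p).
Proof.
case/memv_addP=> u uD [_ /memv_imgP[t tD ->] ->]; rewrite lfunE linearD /=.
have bdryI q s : s \in supp_sp (dep_par (~~ q)) -> bdry s \in ideal_par q.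
  move=> sD; apply: (subvP (addvSr _ _)).
  by apply/memv_imgP; exists s; rewrite // lfunE.
have depI q s : s \in supp_sp (dep_par q) -> s \in ideal_par q.
  by move=> sD; apply: (subvP (addvSl _ _)).
have atom_mulD q s : s \in supp_sp (dep_par q) -> atom_mul s \in supp_sp (dep_par (~~ q)).
  by move=> sD; apply: atom_mul_supp sD => c; apply: atom_mul_elt_dep.
rewrite memvD //.
  by rewrite memvD ?bdryI ?depI ?atom_mulD ?negbK.
have tB : t \in supp_sp below.
  exact: (subvP (below_parS _)) _ (subvP (dep_par_below _) _ tD).
have -> : clifford (bdry t) = t - bdry (atom_mul t).
  by rewrite /clifford bdry_bdry add0r; apply: (canRL (addrK _)); apply: homotopy.
by apply: memvB; [apply: depI | apply/bdryI/atom_mulD].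
Qed.

Lemma limg_dim_leq (f : 'End(FS)) (U : {vspace FS}) : (\dim (f @: U) <= \dim U)%N.
Proof. by rewrite -(limg_ker_dim f U) leq_addl. Qed.

Lemma clifford_dim_leq (U : {vspace FS}) : (U <= supp_sp below)%VS ->
  (\dim U <= \dim (linfun clifford @: U))%N.
Proof.
move=> /subvP UB; apply: leq_trans (limg_dim_leq (linfun clifford) _).
apply/dimvS/subvP=> v vU; apply/memv_imgP; exists (clifford v).
  by apply/memv_imgP; exists v; rewrite ?lfunE.
by rewrite lfunE /= cliffordK // UB.
Qed.

Lemma dim_ideal_par p : \dim (ideal_par p) = \dim (ideal_par (~~ p)).
Proof.
have le q : (\dim (ideal_par q) <= \dim (ideal_par (~~ q)))%N.
  apply: leq_trans (clifford_dim_leq (subv_trans (ideal_par_below q) (below_parS q))) _.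
  apply/dimvS/subvP=> _ /memv_imgP[u uI ->]; rewrite lfunE /=.
  exact: clifford_ideal.
by apply/eqP; rewrite eqn_leq le /=; have := le (~~ p); rewrite negbK.
Qed.

Lemma card_below_par p : #|below_par p| = #|below_par (~~ p)|.
Proof.
have le q : (#|below_par q| <= #|below_par (~~ q)|)%N.
  rewrite -!dim_supp_sp; apply: leq_trans (clifford_dim_leq (below_parS q)) _.
  apply/dimvS/subvP=> _ /memv_imgP[u uI ->]; rewrite lfunE /=.
  exact: clifford_below.
by apply/eqP; rewrite eqn_leq le /=; have := le (~~ p); rewrite negbK.
Qed.

Definition rank_par p y : bool := (y <= x)%O && (odd (rho y) == p).

(** Modulo dependent elements, the boundary of an element of nullity one is its
    circuit relation, and the boundary of an element of larger nullity vanishes. *)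
Lemma bdry_circ p w : w \in dep_par (~~ p) ->
  (if nullity1 w then bdry (delta w) - circ lo w else bdry (delta w))
    \in supp_sp (dep_par p).
Proof.
rewrite !inE => /andP[/andP[wx /eqP pw] dw].
have mem b : b \in at_S w -> ~~ indep (sdel w b) ->
    sh [set b] (at_S w :\ b) *: delta (sdel w b) \in supp_sp (dep_par p).
  move=> bw db; rewrite memvZ // delta_supp !inE db andbT (at_sdel lsm).
  rewrite (le_trans (le_top (sdel_le lsm w b)) wx) /=.
  by move: pw; rewrite (cardsD1 b (at_S w)) bw /= => /negb_inj ->.
rewrite bdry_delta /bdry_elt /circ; case: ifP => [nw|nw].
  rewrite (bigID (fun b => indep (sdel w b))) /= [X in X - _]addrC addrK.
  by apply: memv_suml => b /andP[bw db]; apply: mem.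
apply: memv_suml => b bw; apply: mem => //; apply: contraFN nw.
exact: (nullity1_sdel lsm).
Qed.

Lemma nullity1_dep_par p w : nullity1 w -> rank_par p (top_S w) -> w \in dep_par (~~ p).
Proof.
move=> nw /andP[wx /eqP pw]; rewrite !inE wx (nullity1_dep nw) andbT /=.
by rewrite (eqP nw) /= pw.
Qed.

Lemma ideal_parE p :
  ideal_par p = (supp_sp (dep_par p) + \sum_(y | rank_par p y) circ_sp y)%VS.
Proof.
have D u : u \in supp_sp (dep_par p) -> u \in ideal_par p by apply: (subvP (addvSl _ _)).
apply/eqP; rewrite eqEsubv !subv_add addvSl /=; apply/andP; split; last first.
  apply/andP; split; first exact: addvSl.
  apply/subv_sumP=> y yp; apply/subv_sumP=> w /andP[nw /eqP wy]; rewrite -memvE.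
  have wD : w \in dep_par (~~ p) by apply: nullity1_dep_par; rewrite ?wy.
  have := bdry_circ wD; rewrite nw => /D wI.
  rewrite -[circ lo w](subKr (bdry (delta w))) memvB //.
  apply: (subvP (addvSr _ _)); apply/memv_imgP; exists (delta w); rewrite ?lfunE //.
  by rewrite delta_supp.
apply/subvP=> _ /memv_imgP[u /memv_sumP[f fw ->] ->].
rewrite linear_sum; apply: memv_suml => w wD.
have /vlineP[k ->] := fw w wD; rewrite linearZ /= lfunE /=; apply: memvZ.
have := bdry_circ wD; case: ifP => [nw|_] wI; last exact: (subvP (addvSl _ _)).
rewrite -[bdry _](subrK (circ lo w)) memvD //; first exact: (subvP (addvSl _ _)).
apply: (subvP (addvSr _ _)); apply: (subvP (sumv_sup (top_S w) _ (subvv _))).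
  move: wD; rewrite !inE => /andP[/andP[wx]]; rewrite (eqP nw) /rank_par wx /=.
  by move/eqP/negb_inj => ->.
by apply: (subvP (sumv_sup w _ (subvv _))); rewrite ?nw ?eqxx ?memv_line.
Qed.

Lemma circ_sum_supp p : (\sum_(y | rank_par p y) circ_sp y <=
  supp_sp [set c in below_par p | indep c])%VS.
Proof.
apply/subv_sumP=> y /andP[yx yp]; apply: subv_trans (circ_sp_fiber y) _.
apply/supp_spS/subsetP=> c; rewrite !inE => /andP[ic /eqP cy].
by rewrite cy yx ic andbT /=; move: ic; rewrite indepE cy => /eqP <-.
Qed.

Lemma dim_ideal_parE p : \dim (ideal_par p) =
  (#|dep_par p| + \sum_(y | rank_par p y) \dim (circ_sp y))%N.
Proof.
rewrite ideal_parE dimv_disjoint_sum.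
  rewrite dim_supp_sp (@dim_sum_disjoint_supp _ _ _ _ top_fiber) //.
    by move=> y _; apply: circ_sp_fiber.
  by move=> y z c _ _; rewrite !inE => /andP[_ /eqP<-] /andP[_ /eqP<-].
apply/eqP; rewrite -subv0; apply/subvP=> v.
rewrite memv_cap memv0 => /andP[/supp_spP vD /(subvP (circ_sum_supp p))/supp_spP vI].
apply/eqP/ffunP=> c; rewrite [RHS]ffunE.
have [ic|dc] := boolP (indep c); first by apply: vD; rewrite inE ic andbF.
by apply: vI; rewrite inE (negPf dc) andbF.
Qed.

Lemma card_below_parE p :
  #|below_par p| = (#|dep_par p| + \sum_(y | rank_par p y) #|top_fiber y|)%N.
Proof.
rewrite -(cardsID [set c | ~~ indep c] (below_par p)); congr (_ + _)%N.
  by apply: eq_card => c; rewrite !inE.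
rewrite -sum1_card (partition_big (@top_S _ _ _) (rank_par p)) /= => [|c].
  apply: eq_bigr => y /andP[yx /eqP yp]; rewrite -sum1_card; apply: eq_bigl => c.
  rewrite !inE negbK; have [cy|] := eqVneq (top_S c) y; last by rewrite !andbF.
  have [ic|] := boolP (indep c); rewrite ?andbF //=.
  by move: ic; rewrite indepE cy => /eqP <-; rewrite yx yp eqxx.
rewrite !inE negbK => /andP[ic /andP[cx cp]]; rewrite /rank_par cx /=.
by move: ic; rewrite indepE => /eqP->.
Qed.

(** The involution [clifford] exchanges the even and the odd parts, both of the
    exterior algebra and of the ideal. *)
Lemma euler_parity :
  \sum_(y | rank_par true y) (top_dim y)%:Z = \sum_(y | rank_par false y) (top_dim y)%:Z.
Proof.
have E p : \sum_(y | rank_par p y) (top_dim y)%:Z =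
    #|below_par p|%:Z - (\dim (ideal_par p))%:Z.
  under eq_bigr => y _ do rewrite top_dimE.
  rewrite sumrB card_below_parE dim_ideal_parE !PoszD opprD addrACA subrr add0r.
  by rewrite !(big_morph Posz PoszD (erefl 0%:Z)).
by rewrite !E card_below_par dim_ideal_par.
Qed.

End Homotopy.

Lemma euler_sum x : (\bot < x)%O ->
  \sum_(y | (y <= x)%O) (-1) ^+ rho y * (top_dim y)%:Z = 0.
Proof.
move=> /(exists_atom lsm)[a aA ax]; have e := euler_parity aA ax.
rewrite (bigID (fun y => odd (rho y))) /=.
rewrite (eq_bigr (fun y => - (top_dim y)%:Z)); last first.
  by move=> y /andP[_ yp]; rewrite -signr_odd yp expr1 mulN1r.
rewrite [X in _ + X](eq_bigr (fun y => (top_dim y)%:Z)); last first.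
  by move=> y /andP[_ yp]; rewrite -signr_odd (negPf yp) expr0 mul1r.
rewrite sumrN; apply/eqP; rewrite addrC subr_eq0; apply/eqP/esym.
transitivity (\sum_(y | rank_par x true y) (top_dim y)%:Z).
  by apply: eq_bigl => y; rewrite /rank_par eqb_id.
by rewrite e; apply: eq_bigl => y; rewrite /rank_par eqbF_neg.
Qed.

Lemma top_dim_bot : top_dim \bot%O = 1%N.
Proof.
have fib : top_fiber \bot%O = [set \bot%O].
  apply/setP=> c; rewrite !inE; apply/andP/eqP => [[ic /eqP c0]|->].
    apply/eqP; rewrite -(at_S_eq0 lsm) -cards_eq0; move: ic.
    by rewrite indepE c0 => /eqP <-; rewrite (rank_eq0 lsm).
  by rewrite indep_bot.
rewrite /top_dim fib cards1 (_ : circ_sp _ = 0%VS) ?dimv0 //.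
apply/eqP; rewrite -subv0; apply/subv_sumP => w /andP[nw /eqP w0].
have /eqP cw : #|at_S w| == 1%N by rewrite (eqP nw) w0 eqSS (rank_eq0 lsm).
have /set0Pn[a aw] : at_S w != set0 by rewrite -cards_eq0 cw.
have := subsetP (at_S_sub w) a aw; rewrite inE.
have := at_le_top aw; rewrite w0 lex0 => /eqP->.
by have := rank_eq0 lsm \bot%O; rewrite eqxx => /eqP->.
Qed.

(** Both sides satisfy the recursion that defines the Moebius function. *)
Lemma moebius_top_dim x : moebius x = (-1) ^+ rho x * (top_dim x)%:Z.
Proof.
have [n] := ubnP #|[set y | (y <= x)%O]|; elim: n x => // n IH x le.
have [->|] := eqVneq x \bot%O.
  by rewrite moebius0 top_dim_bot; have := rank_eq0 lsm \bot%O; rewrite eqxx => /eqP->.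
rewrite -lt0x => x0; have := moebius_sum x0; rewrite (bigD1 x) //= => muE.
have := euler_sum x0; rewrite (bigD1 x) //= => eulerE.
apply: (addIr (\sum_(y | (y <= x)%O && (y != x)) moebius y)).
rewrite muE -[LHS]eulerE; congr (_ + _); apply/esym.
apply: eq_bigr => y /andP[yx nyx]; apply: IH; rewrite -ltnS; apply: leq_trans le; rewrite ltnS.
apply/proper_card/properP; split.
  by apply/subsetP=> z; rewrite !inE => /le_trans->.
by exists x; rewrite !inE ?lexx // lt_geF // lt_neqAle nyx.
Qed.

End EulerCharacteristic.

(** * Lower intervals *)

Section LowerInterval.
Context (d : Order.disp_t) (P : finBPOrderType d) (rho : P -> nat) (lo : rel P).
Hypothesis lsm : local_semimodular rho.
Hypothesis lo_lin : linear_order_on lo (atoms rho).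
Variable x : P.
Local Notation Q := (down x).
Local Notation rhoQ := (rank_le rho (x := x)).
Local Notation loQ := (lo_le lo (x := x)).
Local Notation S := (Sp rho).
Local Notation SQ := (Sp rhoQ).
Implicit Types (y z : Q) (T : {set Q}) (c e w : SQ) (a : Q).

Lemma le_down y z : (y <= z)%O = (val y <= val z)%O. Proof. by []. Qed.
Lemma lt_down y z : (y < z)%O = (val y < val z)%O.
Proof. by rewrite !lt_neqAle. Qed.

Definition in_down (t : P) (tx : (t <= x)%O) : Q := exist (fun t => t <= x)%O t tx.

Lemma rank_function_down : rank_function rho -> rank_function rhoQ.
Proof.
move=> [rmono r0 rcov]; split=> [y z /rmono //|//|y z /andP[yz /forallP no]].
apply: rcov; rewrite /covers -lt_down yz; apply/forallP=> t; apply/negP=> /andP[yt tz].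
have tx : (t <= x)%O := le_trans (ltW tz) (valP z).
by have := no (in_down tx); rewrite !lt_down /= yt tz.
Qed.

Lemma lsm_down : local_semimodular rhoQ.
Proof.
split; first exact: rank_function_down (lsm_rank lsm).
move=> z y t yz tz; have [j [jz yj tj jmin jrk]] := lsm_join lsm yz tz.
exists (in_down (le_trans jz (valP z))); split=> // v vz yv tv.
exact: (jmin (val v)).
Qed.

Lemma lo_lin_down : linear_order_on loQ (atoms rhoQ).
Proof.
have mem y : y \in atoms rhoQ -> val y \in atoms rho by rewrite !inE.
case: lo_lin => refl asym tr tot; split.
- by move=> y /mem; apply: refl.
- by move=> y z /mem yA /mem zA yz; apply/val_inj/asym.
- by move=> y z t /mem yA /mem zA /mem tA; apply: tr.
by move=> y z /mem yA /mem zA; apply: tot.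
Qed.

Fact emb_in_S c : in_S rho (val (top_S c), val @: at_S c).
Proof.
rewrite /in_S /=; apply/andP; split.
  by apply/subsetP=> _ /imsetP[a ac ->]; have := subsetP (at_S_sub c) a ac; rewrite !inE.
have /bigveeP[ub least] := top_vee c.
apply/bigveeP; split=> [_ /imsetP[a ac ->]|v vc vub]; first exact: ub.
have vx : (v <= x)%O := le_trans vc (valP (top_S c)).
have := least (in_down vx) vc; move=> <- // a ac.
by rewrite le_down /= vub // imset_f.
Qed.

(** This identifies S of the lower interval with the elements of S whose first
    component lies below [x]. *)
Definition emb c : S := exist (fun q => in_S rho q) _ (emb_in_S c).

Lemma top_emb c : top_S (emb c) = val (top_S c). Proof. by []. Qed.
Lemma at_emb c : at_S (emb c) = val @: at_S c. Proof. by []. Qed.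

Lemma emb_inj : injective emb.
Proof.
move=> c e E; apply: eq_S; first by apply: val_inj; rewrite -!top_emb E.
by apply: (imset_inj val_inj); rewrite -!at_emb E.
Qed.

Lemma emb_surj (g : S) : (top_S g <= x)%O -> exists c, emb c = g.
Proof.
move=> gx; pose t : Q := in_down gx; pose T := [set a : Q | val a \in at_S g].
have vT : val @: T = at_S g.
  apply/setP=> b; apply/imsetP/idP => [[a aT ->]|bg]; first by move: aT; rewrite inE.
  by exists (in_down (le_trans (at_le_top bg) gx)); rewrite ?inE.
have iS : in_S rhoQ (t, T).
  apply/andP; split.
    apply/subsetP=> a; rewrite !inE => /(subsetP (at_S_sub g)).
    by rewrite inE.
  have /bigveeP[ub least] := top_vee g.
  apply/bigveeP; split=> [a|v vt vub]; first by rewrite inE => /ub.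
  apply/val_inj/least => // b bg.
  have bT : in_down (le_trans (at_le_top bg) gx) \in T by rewrite inE.
  exact: vub bT.
by exists (exist (fun q => in_S rhoQ q) _ iS); apply: eq_S; rewrite // at_emb -vT.
Qed.

Lemma indep_emb c : indep (emb c) = indep c.
Proof. by rewrite !indepE at_emb card_imset //; apply: val_inj. Qed.

Lemma nullity1_emb c : nullity1 (emb c) = nullity1 c.
Proof. by rewrite /nullity1 at_emb card_imset //; apply: val_inj. Qed.

Lemma emb_sdel c a : emb (sdel c a) = sdel (emb c) (val a).
Proof.
have [c' E] : exists c', emb c' = sdel (emb c) (val a).
  apply: emb_surj; have := le_top (sdel_le lsm (emb c) (val a)).
  by rewrite top_emb => /le_trans; apply; apply: (valP (top_S c)).
have atE : at_S c' = at_S c :\ a.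
  apply: (imset_inj val_inj); rewrite -at_emb E (at_sdel lsm) at_emb.
  apply/setP=> b; rewrite !inE; apply/andP/imsetP => [[ba /imsetP[b' b'c E']]|[b' + ->]].
    by exists b'; rewrite // !inE b'c andbT; apply: contra ba => /eqP<-; rewrite E'.
  by rewrite !inE => /andP[b'a b'c]; rewrite imset_f // (inj_eq val_inj).
rewrite -E sdelE -atE flat_eq //; first exact: lsm_down.
by rewrite le_down -!top_emb E le_top // sdel_le.
Qed.

Lemma shuffle_emb (A B : {set Q}) : shuffle lo (val @: A) (val @: B) = shuffle loQ A B.
Proof.
rewrite /shuffle big_imset /=; last by move=> ? ? _ _; apply: val_inj.
apply: eq_bigr => a _; rewrite big_imset //=.
by move=> ? ? _ _; apply: val_inj.
Qed.

Local Notation FS := (funsp S).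
Local Notation FQ := (funsp SQ).

(** Independence is part of the condition so that [pull v] is homogeneous, of
    degree the rank of [x]. *)
Definition pull (v : FS) : FQ :=
  [ffun c : SQ => if indep c && (val (top_S c) == x) then v (emb c) else 0].

Fact pull_linear : linear pull.
Proof.
move=> k u v; apply/ffunP=> c; rewrite funspD funspZ !ffunE.
by case: ifP => _; rewrite ?mulr0 ?addr0 // funspD funspZ.
Qed.
HB.instance Definition _ := GRing.isLinear.Build rat FS FQ *:%R pull pull_linear.

Definition push_elt c : FS := if indep c && (val (top_S c) == x) then delta (emb c) else 0.
Definition push : FQ -> FS := lin_ext push_elt.
HB.instance Definition _ := GRing.isLinear.Build rat FQ FS *:%R push
  (@lin_ext_linear _ _ _).

Lemma push_delta c : push (delta c) = push_elt c.
Proof. exact: lin_ext_delta. Qed.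

Lemma push_comb (I : Type) (r : seq I) (R : pred I) (F : I -> rat) (H : I -> FQ) :
  push (\sum_(i <- r | R i) F i *: H i) = \sum_(i <- r | R i) F i *: push (H i).
Proof. exact: lin_ext_comb. Qed.

Lemma pull_comb (I : Type) (r : seq I) (R : pred I) (F : I -> rat) (H : I -> FS) :
  pull (\sum_(i <- r | R i) F i *: H i) = \sum_(i <- r | R i) F i *: pull (H i).
Proof. by rewrite linear_sum; apply: eq_bigr => i _; rewrite linearZ. Qed.

Lemma pull_delta_emb c :
  pull (delta (emb c)) = if indep c && (val (top_S c) == x) then delta c else 0.
Proof.
apply/ffunP=> e; rewrite ffunE deltaE (inj_eq emb_inj).
have [->|ec] := eqVneq e c; first by case: ifP; rewrite ?deltaE ?eqxx // funsp0.
by rewrite if_same; case: ifP; rewrite ?deltaE ?(negPf ec) // funsp0.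
Qed.

Lemma pull_delta_out (g : S) : top_S g != x -> pull (delta g) = 0.
Proof.
move=> gx; apply/ffunP=> e; rewrite ffunE deltaE funsp0; case: ifP => // /andP[_ /eqP ex].
by case: eqP => // E; rewrite -E top_emb ex eqxx in gx.
Qed.

Lemma circ_emb w : circ lo (emb w) = \sum_(a in at_S w | indep (sdel w a))
  shuffle loQ [set a] (at_S w :\ a) *: delta (emb (sdel w a)).
Proof.
rewrite /circ at_emb big_imset_cond /=; last by move=> ? ? _ _; apply: val_inj.
apply: eq_big => [a|a _]; rewrite -emb_sdel ?indep_emb //; congr (_ *: _).
rewrite -shuffle_emb imset_set1; congr shuffle.
apply/setP=> b; rewrite !inE; apply/andP/imsetP => [[ba /imsetP[b' b'w E]]|[b' + ->]].
  by exists b'; rewrite // !inE b'w andbT; apply: contra ba => /eqP<-; rewrite E.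
by rewrite !inE => /andP[b'a b'w]; rewrite imset_f // (inj_eq val_inj).
Qed.

Lemma pull_circ w : nullity1 w -> val (top_S w) = x -> pull (circ lo (emb w)) = circ loQ w.
Proof.
move=> nw wx; rewrite circ_emb pull_comb /circ; apply: eq_bigr => a /andP[aw iwa].
rewrite pull_delta_emb iwa.
by rewrite (top_sdel_indep lsm_down (nullity1_dep nw)) // wx eqxx.
Qed.

Lemma push_circ w : nullity1 w ->
  push (circ loQ w) = if val (top_S w) == x then circ lo (emb w) else 0.
Proof.
move=> nw; rewrite circ_emb /circ push_comb.
case: ifPn => wx; last first.
  rewrite big1 // => a /andP[aw iwa]; rewrite push_delta /push_elt iwa.
  by rewrite (top_sdel_indep lsm_down (nullity1_dep nw)) // (negPf wx) scaler0.
apply: eq_bigr => a /andP[aw iwa]; rewrite push_delta /push_elt iwa.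
by rewrite (top_sdel_indep lsm_down (nullity1_dep nw)) // wx.
Qed.

Lemma pull_rel v : v \in rel_sp rho lo -> pull v \in rel_sp rhoQ loQ.
Proof.
suff : (rel_sp rho lo <= linfun pull @^-1: rel_sp rhoQ loQ)%VS.
  by move=> /subvP h /h; rewrite -memv_preim lfunE.
apply: rel_sp_ind => [g dg|g ng]; rewrite -memv_preim lfunE /=.
  have [gx|gx] := eqVneq (top_S g) x; last by rewrite pull_delta_out ?mem0v.
  have [c cE] : exists c, emb c = g by apply: emb_surj; rewrite gx.
  by rewrite -cE pull_delta_emb -indep_emb cE (negPf dg) mem0v.
have [gx|gx] := eqVneq (top_S g) x; last first.
  rewrite /circ pull_comb big1 ?mem0v // => b /andP[bg ig].
  by rewrite pull_delta_out ?scaler0 // (top_sdel_indep lsm (nullity1_dep ng)).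
have [w wE] : exists w, emb w = g by apply: emb_surj; rewrite gx.
have nw : nullity1 w by rewrite -nullity1_emb wE.
have wx : val (top_S w) = x by apply: etrans (congr1 (@top_S _ _ _) wE) gx.
by rewrite -wE pull_circ //; apply: circ_rel.
Qed.

Lemma push_rel u : u \in rel_sp rhoQ loQ -> push u \in rel_sp rho lo.
Proof.
suff : (rel_sp rhoQ loQ <= linfun push @^-1: rel_sp rho lo)%VS.
  by move=> /subvP h /h; rewrite -memv_preim lfunE.
apply: rel_sp_ind => [c dc|w nw]; rewrite -memv_preim lfunE /=.
  by rewrite push_delta /push_elt (negPf dc) mem0v.
rewrite push_circ //; case: ifP => _; last exact: mem0v.
by apply: circ_rel; rewrite nullity1_emb.
Qed.

Lemma pushE u (g : S) : push u g =
  if indep g && (top_S g == x) then \sum_(c | emb c == g) u c else 0.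
Proof.
rewrite /push /lin_ext funsp_sum; case: ifPn => [/andP[ig /eqP gx]|ng].
  rewrite [RHS]big_mkcond; apply: eq_bigr => c _; rewrite funspZ /push_elt.
  have [cE|cE] := eqVneq (emb c) g.
    by rewrite -indep_emb -top_emb cE ig gx eqxx deltaE eqxx mulr1.
  case: ifP => _; last by rewrite funsp0 mulr0.
  by rewrite deltaE eq_sym (negPf cE) mulr0.
rewrite big1 // => c _; rewrite funspZ /push_elt.
case: ifP => [ct|_]; last by rewrite funsp0 mulr0.
rewrite deltaE; case: (eqVneq g (emb c)) => [gE|_]; last by rewrite mulr0.
by rewrite gE indep_emb top_emb ct in ng.
Qed.

Lemma push_emb u c : push u (emb c) =
  if indep c && (val (top_S c) == x) then u c else 0.
Proof.
rewrite pushE indep_emb top_emb; case: ifP => // _.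
by rewrite (big_pred1 c) // => e; rewrite /= (inj_eq emb_inj).
Qed.

Lemma push_out u (g : S) : ~~ (indep g && (top_S g == x)) -> push u g = 0.
Proof. by move=> /negPf ng; rewrite pushE ng. Qed.

Lemma push_pull v (g : S) : push (pull v) g = if indep g && (top_S g == x) then v g else 0.
Proof.
case: ifPn => [/andP[ig /eqP gx]|/push_out -> //].
have [c cE] : exists c, emb c = g by apply: emb_surj; rewrite gx.
have ic : indep c by rewrite -indep_emb cE.
have cx : val (top_S c) == x by apply/eqP; apply: etrans (congr1 (@top_S _ _ _) cE) gx.
by rewrite -cE push_emb ffunE ic cx.
Qed.

Lemma pull_supp v : pull v \in supp_sp (deg_S rhoQ (rho x)).
Proof.
apply/supp_spP => c; rewrite inE ffunE; case: ifP => // /andP[].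
by rewrite indepE /rank_le => /eqP <- /eqP ->; rewrite eqxx.
Qed.

Lemma pull_push u : u \in supp_sp (deg_S rhoQ (rho x)) ->
  pull (push u) - u \in rel_sp rhoQ loQ.
Proof.
move=> /supp_spP ux; apply/dep_rel/supp_spP => c; rewrite inE negbK => ic.
rewrite funspB ffunE push_emb ic /=; case: eqP => [//|cx]; first by rewrite subrr.
rewrite sub0r ux ?oppr0 // inE; apply/eqP => cr; apply: cx.
apply: (rank_inj_le lsm); first exact: (valP (top_S c)).
by rewrite -cr; move: ic; rewrite indepE => /eqP.
Qed.

End LowerInterval.

(** * Locally geometric posets *)

Section LocallyGeometric.
Local Open Scope order_scope.

Lemma rank_function_uniq (d : Order.disp_t) (P : finBPOrderType d) (r r' : P -> nat) :
  rank_function r -> rank_function r' -> r =1 r'.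
Proof.
(* Both functions grow by one at each step of a saturated chain up to [y]. *)
move=> [_ r0 rc] [_ r0' rc'] y; suff: (r y + r' \bot = r' y + r \bot)%N.
  by rewrite r0 r0' !addn0.
have : \bot <= y by exact: le0x.
move: (\bot) => x; have [n] := ubnP #|[set u | (x <= u) && (u <= y)]|.
elim: n x => // n IH x le; rewrite le_eqVlt => /orP[/eqP->|/exists_cover[w xw wy]].
  exact: addnC.
have ltxw : x < w by case/andP: xw.
have xy : x <= y := le_trans (ltW ltxw) wy.
have : (r y + r' w = r' y + r w)%N.
  apply: IH wy; rewrite -ltnS; apply: leq_trans le; rewrite ltnS.
  apply/proper_card/properP; split.
    by apply/subsetP=> u; rewrite !inE => /andP[/(le_trans (ltW ltxw)) -> ->].
  by exists x; rewrite !inE ?lexx ?xy // (lt_geF ltxw).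
by rewrite (rc _ _ xw) (rc' _ _ xw) !addnS => -[].
Qed.

Lemma exists_minimal_ub (d : Order.disp_t) (P : finPOrderType d) (x y v : P) :
  x <= v -> y <= v -> exists2 u, u \in vee x y & u <= v.
Proof.
move=> xv yv; have v0 : [&& x <= v, y <= v & v <= v] by rewrite xv yv lexx.
case: (@arg_minnP _ v (fun u => [&& x <= u, y <= u & u <= v])
  (fun u => #|[set t | t <= u]|) v0) => u /and3P[xu yu uv] umin.
have ubP t : (t \in ubs [set x; y]) = (x <= t) && (y <= t).
  rewrite inE; apply/forall_inP/andP => [h|[h1 h2] s]; first by rewrite !h // !inE eqxx ?orbT.
  by rewrite !inE => /orP[]/eqP->.
exists u => //; rewrite inE ubP xu yu /=; apply/forall_inP=> t; rewrite ubP => /andP[xt yt].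
apply/negP=> tu; have := umin t; rewrite xt yt (le_trans (ltW tu) uv) => /(_ isT).
rewrite leqNgt => /negP[]; apply/proper_card/properP; split.
  by apply/subsetP=> s; rewrite !inE => /le_trans; apply; apply: ltW.
by exists u; rewrite !inE ?lexx // (lt_geF tu).
Qed.

(** The lattice below [z] has [rho] as its only rank function, so its
    semimodularity is a statement about [rho]. *)
Lemma lsm_locally_geometric (d : Order.disp_t) (P : finBPOrderType d) (rho : P -> nat) :
  locally_geometric P -> rank_function rho -> local_semimodular rho.
Proof.
move=> [_ geo] rk; split=> // z x y xz yz.
have [lat [r [rk' _ sm]]] := geo z.
pose X : down z := in_down xz; pose Y : down z := in_down yz.
have rE := rank_function_uniq rk' (rank_function_down z rk).
have [/eqP/cards1P[J vJ] /eqP/cards1P[M wM]] := lat X Y.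
have Jv : J \in vee X Y by rewrite vJ set11.
have Mw : M \in wedge X Y by rewrite wM set11.
have /ubsP ubJ : J \in ubs [set X; Y] by move: Jv; rewrite inE => /andP[].
exists (val J); split.
- exact: (valP J).
- by apply: (ubJ X); rewrite !inE eqxx.
- by apply: (ubJ Y); rewrite !inE eqxx orbT.
- move=> v vz xv yv.
  have [u] := @exists_minimal_ub _ (down z) X Y (in_down vz) xv yv.
  by rewrite vJ inE => /eqP->.
move=> ry; have := sm X Y J M Jv Mw; rewrite !rE /rank_le /= ry addn1.
exact: leq_trans (leq_addr _ _).
Qed.

End LocallyGeometric.

(** * The decomposition *)

Section Decomposition.
Context (d : Order.disp_t) (P : finBPOrderType d) (rho : P -> nat) (lo : rel P).
Hypothesis lsm : local_semimodular rho.
Hypothesis lo_lin : linear_order_on lo (atoms rho).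
Local Notation S := (Sp rho).
Local Notation FS := (funsp S).
Implicit Types (v : FS) (x : P).

(** The projection of the algebra onto its summand at [x], on representatives. *)
Definition component x v : OS (rank_le rho (x := x)) (lo_le lo (x := x)) :=
  to_OS (lo_le lo (x := x)) (pull x v).

Lemma component_homog x v : component x v \in homogOS (lo := lo_le lo (x := x)) (rho x).
Proof.
apply/(homogP (lsm_down lsm x) (lo_lin_down lo_lin x)).
by exists (pull x v) => //; apply: pull_supp.
Qed.

Lemma component_eq0 x v : component x v = 0 <-> pull x v \in rel_sp _ (lo_le lo (x := x)).
Proof. exact: (to_OS_eq0 (lsm_down lsm x) (lo_lin_down lo_lin x)). Qed.

Lemma component_linear x : linear (component x).
Proof. by move=> k u v; rewrite /component linearP to_OS_lin. Qed.

(** Each relation is supported on a single first component, so that [rel_sp] is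
    the direct sum of the relations of the top components of lower intervals. *)
Lemma rel_sp_pull v : v \in rel_sp rho lo <->
  forall x, pull x v \in rel_sp _ (lo_le lo (x := x)).
Proof.
split=> [vR x|vR]; first exact: pull_rel.
have E : v - \sum_x push (pull x v) \in rel_sp rho lo.
  apply/dep_rel/supp_spP => g; rewrite inE negbK => ig.
  rewrite funspB funsp_sum (bigD1 (top_S g)) //= push_pull // ig eqxx /=.
  rewrite big1 ?addr0 ?subrr // => x /negPf xg.
  by rewrite push_pull // eq_sym xg andbF.
rewrite -[v](subrK (\sum_x push (pull x v))) rpredD // rpred_sum // => x _.
by apply: push_rel.
Qed.

Lemma component_surj (b : forall x, OSdeg_le rho lo x (rho x)) :
  exists v, forall x, component x v = val (b x).
Proof.
have uP x : exists2 u, u \in supp_sp (deg_S _ (rho x)) & to_OS (lo_le lo (x := x)) u = val (b x).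
  by apply/(homogP (lsm_down lsm x) (lo_lin_down lo_lin x)); apply: (valP (b x)).
pose u x := s2val (cid2 (uP x)).
have uD x : u x \in supp_sp (deg_S _ (rho x)) by rewrite /u; case: cid2.
have uE x : to_OS (lo_le lo (x := x)) (u x) = val (b x) by rewrite /u; case: cid2.
exists (\sum_x push (u x)) => x; rewrite -uE; apply/eqP; rewrite -subr_eq0 -linearB; apply/eqP.
apply/(to_OS_eq0 (lsm_down lsm x) (lo_lin_down lo_lin x)).
have -> : pull x (\sum_y push (u y)) = pull x (push (u x)).
  apply/ffunP=> c; rewrite !ffunE; case: ifP => // /andP[ic /eqP cx].
  rewrite funsp_sum (bigD1 x) //= big1 ?addr0 // => y /negPf yx.
  by rewrite push_out // indep_emb ic /= top_emb cx eq_sym yx.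
exact: pull_push.
Qed.

End Decomposition.

(** * Degrees and dimensions *)

Section Degrees.
Context (d : Order.disp_t) (P : finBPOrderType d) (rho : P -> nat) (lo : rel P).
Hypothesis lsm : local_semimodular rho.
Hypothesis lo_lin : linear_order_on lo (atoms rho).
Local Notation S := (Sp rho).
Local Notation FS := (funsp S).
Implicit Types (v : FS) (x : P) (j : nat).

Definition deg_part j v : FS := [ffun c : S => if #|at_S c| == j then v c else 0].

Fact deg_part_linear j : linear (deg_part j).
Proof.
move=> k u v; apply/ffunP=> c; rewrite funspD funspZ !ffunE.
by case: ifP => _; rewrite ?mulr0 ?addr0 // funspD funspZ.
Qed.
HB.instance Definition _ j := GRing.isLinear.Build rat FS FS *:%R (deg_part j)
  (deg_part_linear j).

Lemma deg_part_supp j v : deg_part j v \in supp_sp (deg_S rho j).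
Proof. by apply/supp_spP=> c; rewrite inE ffunE => /negPf->. Qed.

Lemma deg_part_id j v : v \in supp_sp (deg_S rho j) -> deg_part j v = v.
Proof.
move=> /supp_spP vj; apply/ffunP=> c; rewrite ffunE; case: ifPn => // cj.
by rewrite vj // inE.
Qed.

Lemma pull_deg_part j x v : pull x (deg_part j v) = if rho x == j then pull x v else 0.
Proof.
apply/ffunP=> c; rewrite ffunE; have [E|E] := eqVneq (rho x) j.
  rewrite [RHS]ffunE; case: ifP => // /andP[ic /eqP cx]; rewrite ffunE.
  by move: (ic); rewrite -indep_emb indepE top_emb cx E => /eqP <-; rewrite eqxx.
rewrite funsp0; case: ifP => // /andP[ic /eqP cx]; rewrite ffunE.
by move: (ic); rewrite -indep_emb indepE top_emb cx => /eqP <-; rewrite (negPf E).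
Qed.

Lemma to_OS_deg_part j v : to_OS lo (deg_part j v) \in homogOS (lo := lo) j.
Proof.
by apply/(homogP lsm lo_lin); exists (deg_part j v) => //; apply: deg_part_supp.
Qed.

Definition to_OS_deg j v : OSdeg rho lo j :=
  exist (fun a => a \in homogOS (lo := lo) j) _ (to_OS_deg_part j v).

Fact to_OS_deg_linear j : linear (to_OS_deg j).
Proof. by move=> k u v; apply/val_inj; rewrite /= linearP to_OS_lin. Qed.
HB.instance Definition _ j := GRing.isLinear.Build rat FS (OSdeg rho lo j) *:%R
  (to_OS_deg j) (to_OS_deg_linear j).

Lemma to_OS_deg_surj j (a : OSdeg rho lo j) : exists v, to_OS_deg j v = a.
Proof.
have /(homogP lsm lo_lin)[v vj E] := valP a.
by exists v; apply/val_inj; rewrite /= deg_part_id.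
Qed.

Lemma to_OS_deg_eq0 j v : to_OS_deg j v = 0 <-> deg_part j v \in rel_sp rho lo.
Proof.
rewrite -(to_OS_eq0 lsm lo_lin); split=> [/(congr1 val) //|E].
exact/val_inj.
Qed.

Lemma component_deg_homog x j v : rho x = j ->
  component lo x v \in homogOS (lo := lo_le lo (x := x)) j.
Proof. by move=> <-; apply: component_homog. Qed.

Definition component_deg x j (xj : rho x = j) v : OSdeg_le rho lo x j :=
  exist (fun a => a \in homogOS (lo := lo_le lo (x := x)) j) _ (component_deg_homog v xj).

Lemma component_deg_linear x j (xj : rho x = j) : linear (component_deg xj).
Proof. by move=> k u v; apply/val_inj; rewrite /= component_linear. Qed.

Lemma component_deg_eq0 x j (xj : rho x = j) v :
  component_deg xj v = 0 <-> pull x v \in rel_sp _ (lo_le lo (x := x)).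
Proof.
rewrite -(component_eq0 lsm lo_lin); split=> [/(congr1 val) //|E].
exact/val_inj.
Qed.

Definition decomp v : dsum (fun x : P => OSdeg_le rho lo x (rho x)) :=
  [ffun x => component_deg (erefl (rho x)) v].

Fact decomp_linear : linear decomp.
Proof. by move=> k u v; apply/ffunP=> x; rewrite !ffunE component_deg_linear. Qed.
HB.instance Definition _ := GRing.isLinear.Build rat FS _ *:%R decomp decomp_linear.

Lemma decomp_eq0 v : to_OS lo v = 0 <-> decomp v = 0.
Proof.
rewrite (to_OS_eq0 lsm lo_lin) (rel_sp_pull lo lsm).
split=> [h|/ffunP h x]; last first.
  by have := h x; rewrite !ffunE => /component_deg_eq0.
by apply/ffunP=> x; rewrite !ffunE; apply/component_deg_eq0.
Qed.

Lemma decomp_surj b : exists v, decomp v = b.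
Proof.
have [v vE] := component_surj lsm lo_lin b.
by exists v; apply/ffunP=> x; rewrite ffunE; apply/val_inj/vE.
Qed.

Definition decomp_deg j v :
  dsum (fun x : {x : P | rho x == j} => OSdeg_le rho lo (val x) j) :=
  [ffun x : {x : P | rho x == j} => component_deg (eqP (valP x)) v].

Fact decomp_deg_linear j : linear (decomp_deg j).
Proof. by move=> k u v; apply/ffunP=> x; rewrite !ffunE component_deg_linear. Qed.
HB.instance Definition _ j := GRing.isLinear.Build rat FS _ *:%R (decomp_deg j)
  (decomp_deg_linear j).

Lemma decomp_deg_eq0 j v : to_OS_deg j v = 0 <-> decomp_deg j v = 0.
Proof.
rewrite to_OS_deg_eq0 (rel_sp_pull lo lsm); split=> [h|/ffunP h x].
  apply/ffunP=> x; rewrite !ffunE; apply/component_deg_eq0.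
  by have := h (val x); rewrite pull_deg_part (valP x).
rewrite pull_deg_part; case: eqVneq => [xj|_]; last exact: mem0v.
have xj' : rho x == j by rewrite xj.
have := h (exist (fun x => rho x == j) x xj'); rewrite !ffunE.
by move/component_deg_eq0.
Qed.

Lemma decomp_deg_surj j b : exists v, decomp_deg j v = b.
Proof.
(* The family [b] covers the elements of rank [j]; zero completes it. *)
have bP x : exists bx : OSdeg_le rho lo x (rho x), forall xj : rho x == j,
    val bx = val (b (exist (fun x => rho x == j) x xj)).
  have [xj|nxj] : rho x == j \/ ~ rho x == j by case: (rho x == j); [left | right].
    2: by exists 0.
  pose y : {x : P | rho x == j} := exist (fun x => rho x == j) x xj.
  have bh : val (b y) \in homogOS (lo := lo_le lo (x := x)) (rho x).
    by rewrite (eqP xj); apply: (valP (b y)).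
  exists (exist (fun a => a \in homogOS (lo := lo_le lo (x := x)) (rho x)) _ bh) => xj'.
  by rewrite -(bool_irrelevance xj xj').
have [v vE] := component_surj lsm lo_lin (fun x => projT1 (cid (bP x))).
exists v; apply/ffunP=> -[x xj]; rewrite ffunE; apply/val_inj; rewrite /= vE.
by case: cid => bx /= ->.
Qed.

Lemma decomp_deg_part j v (x : {x : P | rho x == j}) :
  val (decomp (deg_part j v) (val x)) = val (decomp_deg j v x).
Proof. by rewrite !ffunE /= /component pull_deg_part (valP x). Qed.

Lemma decomp_deg_out j v x : rho x != j -> decomp (deg_part j v) x = 0.
Proof.
move=> xj; rewrite ffunE; apply/val_inj => /=.
by rewrite /component pull_deg_part (negPf xj) linear0.
Qed.

Definition indep_deg j : {set S} := [set c | indep c && (#|at_S c| == j)].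

(** The functions whose part of degree [j] is a relation: only the circuit
    relations of elements of rank [j] constrain the degree [j]. *)
Definition ker_deg j : {vspace FS} :=
  (supp_sp (~: indep_deg j) + \sum_(y | rho y == j) circ_sp rho lo y)%VS.

Lemma deg_part_circ j y v : v \in circ_sp rho lo y ->
  deg_part j v = if rho y == j then v else 0.
Proof.
move=> /(subvP (circ_sp_fiber lo lsm y))/supp_spP vy; apply/ffunP=> c; rewrite ffunE.
have [cy|/vy vc] := boolP (c \in top_fiber rho y); last first.
  by rewrite vc if_same; case: ifP; rewrite ?vc ?funsp0.
move: cy; rewrite inE indepE => /andP[/eqP <- /eqP ->].
by case: ifP; rewrite ?funsp0.
Qed.

Lemma ker_degP j v : deg_part j v \in rel_sp rho lo <-> v \in ker_deg j.
Proof.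
split=> [|/memv_addP[u1 /supp_spP u1D [_ /memv_sumP[f fy ->] ->]]].
  case/memv_addP=> u1 /supp_spP u1D [_ /memv_sumP[f fy ->] E].
  have E' : deg_part j v = deg_part j u1 + \sum_(y | rho y == j) f y.
    rewrite -(deg_part_id (deg_part_supp j v)) E linearD linear_sum /=; congr (_ + _).
    rewrite [RHS]big_mkcond; apply: eq_bigr => y _.
    by rewrite (deg_part_circ j (fy y isT)).
  have -> : v = (v - deg_part j v + deg_part j u1) + \sum_(y | rho y == j) f y.
    by rewrite -addrA -E' subrK.
  apply: memv_add; last by apply: memv_sumr => y _; apply: fy.
  apply/supp_spP=> c; rewrite !inE negbK => /andP[ic /eqP cj].
  by rewrite funspD funspB !ffunE cj eqxx subrr add0r u1D // inE ic.
rewrite linearD linear_sum /=; apply: rpredD.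
  apply/dep_rel/supp_spP=> c; rewrite inE negbK => ic; rewrite ffunE; case: ifP => // cj.
  by rewrite u1D // !inE ic cj.
apply: rpred_sum => y yj; rewrite (deg_part_circ j (fy y yj)) yj.
by apply: (subvP (addvSr _ _)); apply: (subvP (sumv_sup y _ (subvv _))) => //; apply: fy.
Qed.

Lemma circ_sum_indep_deg j :
  (\sum_(y | rho y == j) circ_sp rho lo y <= supp_sp (indep_deg j))%VS.
Proof.
apply/subv_sumP=> y /eqP yj; apply: subv_trans (circ_sp_fiber lo lsm y) _.
apply/supp_spS/subsetP=> c; rewrite !inE => /andP[ic /eqP cy].
by rewrite ic /=; move: ic; rewrite indepE cy yj => /eqP <-.
Qed.

Lemma dim_ker_deg j : \dim (ker_deg j) =
  (#|~: indep_deg j| + \sum_(y | rho y == j) \dim (circ_sp rho lo y))%N.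
Proof.
rewrite dimv_disjoint_sum.
  rewrite dim_supp_sp (@dim_sum_disjoint_supp _ _ _ _ (top_fiber rho)) //.
    by move=> y _; apply: circ_sp_fiber.
  by move=> y z c _ _; rewrite !inE => /andP[_ /eqP<-] /andP[_ /eqP<-].
apply/eqP; rewrite -subv0; apply/subvP=> v.
rewrite memv_cap memv0 => /andP[/supp_spP vD /(subvP (circ_sum_indep_deg j))/supp_spP vI].
apply/eqP/ffunP=> c; rewrite [RHS]ffunE.
have [ic|dc] := boolP (c \in indep_deg j); last exact: vI.
by apply: vD; rewrite inE ic.
Qed.

Lemma card_indep_deg j : #|indep_deg j| = (\sum_(y | rho y == j) #|top_fiber rho y|)%N.
Proof.
rewrite -sum1_card (partition_big (@top_S _ _ _) (fun y => rho y == j)) /= => [|c].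
  apply: eq_bigr => y /eqP yj; rewrite -sum1_card; apply: eq_bigl => c.
  rewrite !inE; have [cy|] := eqVneq (top_S c) y; last by rewrite !andbF.
  have [ic|] := boolP (indep c) => //=.
  by move: ic; rewrite indepE cy yj => /eqP <-; rewrite eqxx.
by rewrite inE indepE => /andP[/eqP -> ].
Qed.

Definition hilbert j : nat := (\sum_(y | rho y == j) top_dim rho lo y)%N.

Lemma has_dim_OSdeg j : has_dim (OSdeg rho lo j) (hilbert j).
Proof.
have : has_dim (OSdeg rho lo j) (\dim {:FS} - \dim (ker_deg j)).
  apply: (has_dim_quotient (f := to_OS_deg j)); first exact: to_OS_deg_surj.
  by move=> v; rewrite to_OS_deg_eq0; apply: ker_degP.
suff -> : (\dim {:FS} - \dim (ker_deg j) = hilbert j)%N by [].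
have -> : \dim {:FS} = #|S|.
  rewrite -cardsT -dim_supp_sp; congr (\dim _).
  by apply/eqP; rewrite eqEsubv subvf andbT; apply/subvP=> v _; apply/supp_spP=> c; rewrite inE.
rewrite dim_ker_deg -(cardsC (indep_deg j)) addnC subnDl card_indep_deg /hilbert /top_dim.
rewrite sumnB // => y _; rewrite -dim_supp_sp; apply: dimvS.
exact: circ_sp_fiber.
Qed.

Lemma hilbert_coef j : (hilbert j)%:Z = (\sum_(x : P) moebius x *: (- 'X) ^+ rho x)`_j.
Proof.
rewrite coef_sum /hilbert (big_morph Posz PoszD (erefl 0%:Z)) big_mkcond.
apply: eq_bigr => x _; rewrite coefZ exprNn -signr_odd.
have -> : ((-1) ^+ odd (rho x) * 'X^(rho x))`_j = (-1) ^+ rho x * (j == rho x)%:R :> int.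
  rewrite -[in RHS]signr_odd; case: (odd _); rewrite ?expr1 ?expr0 ?mul1r ?mulN1r ?coefN coefXn //.
rewrite (moebius_top_dim lsm lo_lin) eq_sym; case: eqP => [_|]; last by rewrite !mulr0.
by rewrite mulr1 mulrAC -expr2 sqrr_sign mul1r.
Qed.

End Degrees.

Lemma rank_le_rank_of (d : Order.disp_t) (P : finBPOrderType d) (rho : P -> nat) x :
  (rho x <= rank_of rho)%N.
Proof. exact: leq_bigmax. Qed.

Lemma hilbert_characteristic (d : Order.disp_t) (P : finBPOrderType d) (rho : P -> nat) :
  tofrac (\sum_(x : P) moebius x *: (- 'X) ^+ rho x) =
    (- tofrac 'X) ^+ rank_of rho *
    (map_poly (fun c : int => tofrac c%:P) (characteristic_poly rho)).[- (tofrac 'X)^-1]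
    :> {fraction {poly int}}.
Proof.
pose f : int -> {fraction {poly int}} := fun c => tofrac c%:P.
have X0 : tofrac 'X != 0 :> {fraction {poly int}} by rewrite tofrac_eq0 polyX_eq0.
pose fR : {rmorphism int -> {fraction {poly int}}} := (@tofrac {poly int} \o polyC)%FUN.
rewrite -[map_poly _ _]/(map_poly fR _) /characteristic_poly !rmorph_sum horner_sum mulr_sumr /=.
apply: eq_bigr => x _; rewrite -!mul_polyC !rmorphM /= !rmorphXn /= rmorphN /=.
rewrite map_polyC map_polyX hornerM hornerC hornerXn /= mulrCA; congr (_ * _).
rewrite -{1}(subnK (rank_le_rank_of rho x)) exprD mulrAC -exprMn mulrNN divff // expr1n mul1r.
by [].
Qed.

Theorem theorem3p3p3 (d : Order.disp_t) (P : finBPOrderType d)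
    (rho : P -> nat) (lo : rel P) :
  locally_geometric P ->
  rank_function rho ->
  linear_order_on lo (atoms rho) ->
  (exists phi : {linear OS rho lo ->
                        dsum (fun x : P => OSdeg_le rho lo x (rho x))},
     bijective phi /\
     forall j : nat,
     exists phij : {linear OSdeg rho lo j ->
                           dsum (fun x : {x : P | rho x == j} =>
                                   OSdeg_le rho lo (val x) j)},
       bijective phij /\
       forall a : OSdeg rho lo j,
         (forall x : {x : P | rho x == j},
            val (phi (val a) (val x)) = val (phij a x)) /\
         (forall x : P, rho x != j -> phi (val a) x = 0)) /\
  (exists H : nat -> nat,
     (forall j : nat, has_dim (OSdeg rho lo j) (H j)) /\
     (forall j : nat,
        (H j)%:Z = (\sum_(x : P) moebius x *: (- 'X) ^+ rho x)`_j) /\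
     tofrac (\sum_(x : P) moebius x *: (- 'X) ^+ rho x) =
       (- tofrac 'X) ^+ rank_of rho *
       (map_poly (fun c : int => tofrac c%:P) (characteristic_poly rho))
         .[- (tofrac 'X)^-1]).
Proof.
move=> geo rk lo_lin; have lsm := lsm_locally_geometric geo rk.
split; last first.
  exists (hilbert rho lo); split; first exact: has_dim_OSdeg.
  split; first exact: hilbert_coef.
  exact: hilbert_characteristic.
have [phi phi_bij phiE] := first_iso (to_OS_surj lsm lo_lin) (decomp_surj lsm lo_lin)
  (decomp_eq0 lsm lo_lin).
exists phi; split=> // j.
have [phij phij_bij phijE] := first_iso (to_OS_deg_surj lsm lo_lin (j := j))
  (decomp_deg_surj lsm lo_lin (j := j)) (decomp_deg_eq0 lsm lo_lin j).
exists phij; split=> // a; have [v <-] := to_OS_deg_surj lsm lo_lin a.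
rewrite phijE /= phiE; split=> [x|x xj]; first exact: decomp_deg_part.
exact: decomp_deg_out.
Qed.
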